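(* Let $E$ be a $C^*$-correspondence over a $C^*$-algebra $\mathcal{A}$ and let $(\sigma,T)$ be a completely bounded covariant representation of $E$ on a Hilbert space $\mathcal{H}$ such that: (1) $\|\widetilde{T}\eta\|^2+\|\widetilde{T}_2^*\widetilde{T}\eta\|^2\le 2\|\widetilde{T}^*\widetilde{T}\eta\|^2$ for all $\eta\in E\otimes\mathcal{H}$; (2) $(\sigma,T)$ is bounded below; (3) $\|\widetilde{T}_n^*h\|\to 0$ as $n\to\infty$ for all $h\in\mathcal{H}$. Then the Beurling-type theorem holds for $(\sigma,T)$, i.e. for every $(\sigma,T)$-invariant subspace $\mathcal{K}$ of $\mathcal{H}$, $$\mathcal{K}=\bigvee_{n\ge 0}\widetilde{T}_n(E^{\otimes n}\otimes\mathcal{W}),\qquad \mathcal{W}=\mathcal{K}\ominus\widetilde{T}(E\otimes\mathcal{K}).$$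
   Context: A $C^*$-correspondence over $\mathcal{A}$ is a right Hilbert $\mathcal{A}$-module $E$ with a nondegenerate $*$-homomorphism $\phi:\mathcal{A}\to\mathcal{L}(E)$ (adjointable operators), giving a left action $a\cdot x=\phi(a)x$. A covariant representation of $E$ on $\mathcal{H}$ is a pair $(\sigma,T)$ with $\sigma:\mathcal{A}\to B(\mathcal{H})$ a $*$-representation and $T:E\to B(\mathcal{H})$ linear with $T(a\cdot x\cdot b)=\sigma(a)T(x)\sigma(b)$ for $a,b\in\mathcal{A}$, $x\in E$. It is completely bounded iff $\widetilde{T}(x\otimes h)=T(x)h$ defines a bounded operator $\widetilde{T}:E\otimes_\sigma\mathcal{H}\to\mathcal{H}$ (where $E\otimes_\sigma\mathcal{H}$, written $E\otimes\mathcal{H}$, is the interior tensor product Hilbert space); then $\widetilde{T}(\phi(a)\otimes I_{\mathcal{H}})=\sigma(a)\widetilde{T}$. $E^{\otimes m}$ is the $m$-fold interior tensor product of $E$ with itself over $\phi$. For $m\ge1$, $\widetilde{T}_m:E^{\otimes m}\otimes\mathcal{H}\to\mathcal{H}$ is $\widetilde{T}_m(x_1\otimes\cdots\otimes x_m\otimes h)=T(x_1)\cdots T(x_m)h$; in particular $\widetilde{T}_2=\widetilde{T}(I_E\otimes\widetilde{T})$. For a closed subspace $\mathcal{K}$, $E^{\otimes m}\otimes\mathcal{K}$ is the closed span in $E^{\otimes m}\otimes\mathcal{H}$ of the vectors $x\otimes k$ ($x\in E^{\otimes m}$, $k\in\mathcal{K}$), and for $m=0$ the convention is $\widetilde{T}_0(E^{\otimes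 0}\otimes\mathcal{K})=\mathcal{K}$. $\bigvee$ denotes closed linear span. $(\sigma,T)$ is bounded below if there is $c>0$ with $c\|\eta\|\le\|\widetilde{T}\eta\|$ for all $\eta\in E\otimes\mathcal{H}$. A closed subspace $\mathcal{K}\subseteq\mathcal{H}$ is $(\sigma,T)$-invariant if it is invariant under $\sigma(a)$ for all $a\in\mathcal{A}$ and under $T(x)$ for all $x\in E$. *)

(* Defs.v *)
From HB Require Import structures.
From mathcomp Require Import all_boot all_order all_algebra.
From mathcomp Require Import complex.
From mathcomp Require Import all_classical all_reals.
From mathcomp Require Import topology normedtype sequences.
Import Order.TTheory GRing.Theory Num.Theory.
Import numFieldNormedType.Exports.

Set Implicit Arguments.
Unset Strict Implicit.
Unset Printing Implicit Defensive.

Local Open Scope classical_set_scope.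
Local Open Scope ring_scope.

Section subspaces.
Context {R : realType} {V : normedModType R[i]}.

Definition closed_subspace (K : set V) : Prop :=
  [/\ closed K, K 0 & forall (c : R[i]) x y, K x -> K y -> K (c *: x + y)].

Definition closed_span (S : set V) : set V := smallest closed_subspace S.

End subspaces.

Definition bounded_operator {R : realType} {U V : normedModType R[i]}
    (f : U -> V) : Prop :=
  linear f /\ exists M : R[i], forall u, `|f u| <= M * `|u|.

(* C*-algebras need not be unital, so the product cannot come from the (unital)
   ring structures of the library. *)
HB.mixin Record isCStarAlgebra (R : realType) A
    of CompleteNormedModule R[i] A := {
  amul : A -> A -> A;
  astar : A -> A;
  amulA : associative amul;
  amul_linearl : forall (c : R[i]) a b d,
    amul (c *: a + b) d = c *: amul a d + amul b d;
  amul_linearr : forall (c : R[i]) a b d,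
    amul d (c *: a + b) = c *: amul d a + amul d b;
  amul_norm : forall a b, `|amul a b| <= `|a| * `|b|;
  astar_antilinear : forall (c : R[i]) a b,
    astar (c *: a + b) = c^* *: astar a + astar b;
  astarM : forall a b, astar (amul a b) = amul (astar b) (astar a);
  astarK : involutive astar;
  cstar_identity : forall a, `|amul (astar a) a| = `|a| ^+ 2
}.

#[short(type="cstarAlgType")]
HB.structure Definition CStarAlgebra (R : realType) :=
  {A of isCStarAlgebra R A & CompleteNormedModule R[i] A}.

Definition apositive {R : realType} {A : cstarAlgType R} (a : A) : Prop :=
  exists b : A, a = amul (astar b) b.

(* The [A]-valued inner product is linear in the second variable. *)
HB.mixin Record isHilbertModule (R : realType) (A : cstarAlgType R) E
    of CompleteNormedModule R[i] E := {
  ract : E -> A -> E;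
  adot : E -> E -> A;
  ract_linearl : forall (c : R[i]) x y a,
    ract (c *: x + y) a = c *: ract x a + ract y a;
  ract_linearr : forall (c : R[i]) x a b,
    ract x (c *: a + b) = c *: ract x a + ract x b;
  ractM : forall x a b, ract x (amul a b) = ract (ract x a) b;
  adot_linearr : forall (c : R[i]) x y z,
    adot x (c *: y + z) = c *: adot x y + adot x z;
  adot_ract : forall x y a, adot x (ract y a) = amul (adot x y) a;
  adot_star : forall x y, astar (adot x y) = adot y x;
  adot_positive : forall x, apositive (adot x x);
  adot_norm : forall x, `|x| ^+ 2 = `|adot x x|
}.

#[short(type="hilbertModType")]
HB.structure Definition HilbertModule (R : realType) (A : cstarAlgType R) :=
  {E of isHilbertModule R A E & CompleteNormedModule R[i] E}.

(* [lact a] is $\phi(a)$; [lact_adot] says both that $\phi(a)$ is adjointable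
   and that $\phi(a)^* = \phi(a^* )$. Linearity of $\phi(a)$ and its commutation
   with the right action follow from adjointability. *)
HB.mixin Record isCStarCorrespondence (R : realType) (A : cstarAlgType R) E
    of HilbertModule R A E := {
  lact : A -> E -> E;
  lact_linearl : forall (c : R[i]) a b x,
    lact (c *: a + b) x = c *: lact a x + lact b x;
  lactM : forall a b x, lact (amul a b) x = lact a (lact b x);
  lact_adot : forall a x y, adot (lact a x) y = adot x (lact (astar a) y);
  lact_nondegenerate :
    closed_span [set z | exists a x, z = lact a x] = [set: E]
}.

#[short(type="cstarCorrType")]
HB.structure Definition CStarCorrespondence (R : realType)
    (A : cstarAlgType R) :=
  {E of isCStarCorrespondence R A E & HilbertModule R A E}.

(* As for every [{dot _ for _}], the scalar inner product is linear in the
   first variable. *)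
HB.mixin Record isHilbert (R : realType) H of CompleteNormedModule R[i] H := {
  hdot : {dot H for Num.conj};
  hdot_norm : forall h : H, `|h| ^+ 2 = hdot h h
}.

#[short(type="hilbertType")]
HB.structure Definition Hilbert (R : realType) :=
  {H of isHilbert R H & CompleteNormedModule R[i] H}.

Definition adjoint {R : realType} {U V : hilbertType R} (f : U -> V) : V -> U :=
  xget (fun=> 0) [set g | forall u v, hdot (f u) v = hdot u (g v)].

Definition ominus {R : realType} {H : hilbertType R} (K L : set H) : set H :=
  [set k | K k /\ forall l, L l -> hdot k l = 0].

(* A realization of the interior tensor product $E \otimes_\phi F$. The inner
   product formula and the totality of the elementary tensors determine it up
   to a unique unitary bimodule map that respects elementary tensors. *)
Record interior_tensor (R : realType) (A : cstarAlgType R)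
    (E F : cstarCorrType A) := InteriorTensor {
  itensor :> cstarCorrType A;
  tens : E -> F -> itensor;
  tens_linearl : forall (c : R[i]) x y z,
    tens (c *: x + y) z = c *: tens x z + tens y z;
  tens_linearr : forall (c : R[i]) x y z,
    tens x (c *: y + z) = c *: tens x y + tens x z;
  tens_balanced : forall x a y, tens (ract x a) y = tens x (lact a y);
  tens_ract : forall x y a, ract (tens x y) a = tens x (ract y a);
  tens_lact : forall a x y, lact a (tens x y) = tens (lact a x) y;
  tens_adot : forall x y x' y',
    adot (tens x y) (tens x' y') = adot y (lact (adot x x') y');
  tens_total : closed_span [set z | exists x y, z = tens x y] = [set: itensor]
}.

(* A realization of the Hilbert space $F \otimes_\sigma H$. The inner product
   formula is insensitive to which variable of the scalar inner products is the
   linear one. *)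
Record hilbert_tensor (R : realType) (A : cstarAlgType R) (F : hilbertModType A)
    (H : hilbertType R) (sigma : A -> H -> H) := HilbertTensor {
  htensor :> hilbertType R;
  htens : F -> H -> htensor;
  htens_linearl : forall (c : R[i]) x y h,
    htens (c *: x + y) h = c *: htens x h + htens y h;
  htens_linearr : forall (c : R[i]) x h k,
    htens x (c *: h + k) = c *: htens x h + htens x k;
  htens_balanced : forall x a h, htens (ract x a) h = htens x (sigma a h);
  htens_hdot : forall x h y k,
    hdot (htens x h) (htens y k) = hdot h (sigma (adot x y) k);
  htens_total : closed_span [set z | exists x h, z = htens x h] = [set: htensor]
}.

Record covariant_rep (R : realType) (A : cstarAlgType R) (E : cstarCorrType A)
    (H : hilbertType R) := CovariantRep {
  sigma : A -> H -> H;
  repT : E -> H -> H;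
  sigma_bounded : forall a, bounded_operator (sigma a);
  repT_bounded : forall x, bounded_operator (repT x);
  sigma_linear : forall (c : R[i]) a b h,
    sigma (c *: a + b) h = c *: sigma a h + sigma b h;
  sigmaM : forall a b h, sigma (amul a b) h = sigma a (sigma b h);
  sigma_star : forall a h k, hdot (sigma a h) k = hdot h (sigma (astar a) k);
  repT_linear : forall (c : R[i]) x y h,
    repT (c *: x + y) h = c *: repT x h + repT y h;
  repT_covariant : forall a x b h,
    repT (ract (lact a x) b) h = sigma a (repT x (sigma b h))
}.

Section representation.
Context {R : realType} {A : cstarAlgType R} {E : cstarCorrType A}.

(* The realization of $E \otimes_\phi F$ chosen for each [F]. *)
Context (ten : forall F : cstarCorrType A, interior_tensor E F).

(* [tpow n] is $E^{\otimes (n+1)}$. *)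
Fixpoint tpow (n : nat) : cstarCorrType A :=
  if n is m.+1 then ten (tpow m) else E.

(* $x_1 \otimes \dots \otimes x_{n+1}$ *)
Fixpoint etens (n : nat) : n.+1.-tuple E -> tpow n :=
  match n return n.+1.-tuple E -> tpow n with
  | 0 => fun xs => thead xs
  | m.+1 => fun xs =>
      tens (ten (tpow m)) (thead xs) (etens [tuple of behead xs])
  end.

Context {H : hilbertType R} (S : covariant_rep E H).

(* The realization of $F \otimes_\sigma H$ chosen for each [F]. *)
Context (tenH : forall F : hilbertModType A, hilbert_tensor F (sigma S)).

Definition is_Ttilde (f : tenH E -> H) : Prop :=
  bounded_operator f /\ forall x h, f (htens (tenH E) x h) = repT S x h.

Definition completely_bounded : Prop := exists f, is_Ttilde f.

Definition Ttilde : tenH E -> H := xget (fun=> 0) [set f | is_Ttilde f].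

(* [TtildeS n] is $\widetilde T_{n+1}$. *)
Definition TtildeS (n : nat) : tenH (tpow n) -> H :=
  xget (fun=> 0) [set f | bounded_operator f /\
    forall (xs : n.+1.-tuple E) h,
      f (htens (tenH (tpow n)) (etens xs) h) = foldr (repT S) h xs].

Definition bounded_below : Prop :=
  exists2 c : R[i], 0 < c & forall eta : tenH E, c * `|eta| <= `|Ttilde eta|.

Definition invariant_subspace (K : set H) : Prop :=
  [/\ closed_subspace K,
      forall a k, K k -> K (sigma S a k) &
      forall x k, K k -> K (repT S x k)].

(* $F \otimes K$ *)
Definition tenK (F : hilbertModType A) (K : set H) : set (tenH F) :=
  closed_span [set z | exists x k, K k /\ z = htens (tenH F) x k].

Arguments TtildeS n eta : clear implicits.
Arguments tenK F K : clear implicits.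

(* $\widetilde T_n(E^{\otimes n} \otimes K)$ *)
Definition Tn_image (n : nat) (K : set H) : set H :=
  if n is m.+1 then TtildeS m @` tenK (tpow m) K else K.

Definition wandering_subspace (K : set H) : set H :=
  ominus K (Ttilde @` tenK E K).

Definition Beurling_type : Prop :=
  forall K : set H, invariant_subspace K ->
    K = closed_span (\bigcup_n Tn_image n (wandering_subspace K)).

End representation.

Arguments Ttilde {R A E H S} tenH eta.
Arguments TtildeS {R A E} ten {H S} tenH n eta.
Arguments tenK {R A E H S} tenH F K _.

(* Main.v *)
(* Write D_n for the amplification of T~ from the (n+1)-st to the n-th level
   E^n ⊗ H of the Fock tower.  Hypothesis (1) says
   |T~ u|^2 + |D_1^* A u|^2 <= 2 |A u|^2 with A = T~^* T~, and, the range of A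
   being dense, this is equivalent to the dual inequality
     |D_1 z + u|^2 <= 2 (|z|^2 + |D_0 u|^2),
   which, unlike (1), is obviously inherited by invariant subspaces.
   It says that an operator commuting with the left action of the C*-algebra is
   positive, so it survives tensoring with the identity of E and holds at every
   level.  Now let h in K be orthogonal to all T~_n (E^n ⊗ W), and let g_n be
   the projection of T~_n^* h onto E^n ⊗ K.  Then g_n is a limit of vectors
   D_n u with u in E^(n+1) ⊗ K, and pairing D_(n+1) g_(n+2) + u with g_(n+1) in
   the dual inequality gives |g_n|^2 + |g_(n+2)|^2 <= 2 |g_(n+1)|^2.  A
   nonnegative concave sequence is nondecreasing, and |g_n| -> 0, so h = g_0 = 0.

   The amplifications I ⊗ B of a positive B are bounded and positive by a
   moment argument that avoids the square root of B: for 0 <= X <= c the moments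
   m_k = <(I ⊗ X^k) z, z> of a finite sum z of elementary tensors are O(c^k) and
   m_k^2 <= m_0 m_(2k), which forces m_1 <= c m_0.  The left actions are bounded
   because 1 - a is a square when a = a^* has norm at most 3/4. *)

Require Import Defs.
From mathcomp Require Import all_boot all_order all_algebra.
From mathcomp Require Import complex.
From mathcomp Require Import all_classical all_reals.
From mathcomp Require Import topology normedtype sequences.
From mathcomp Require Import ring lra.
Import Order.TTheory GRing.Theory Num.Theory.
Import numFieldNormedType.Exports.

Set Implicit Arguments.
Unset Strict Implicit.
Unset Printing Implicit Defensive.

Local Open Scope classical_set_scope.
Local Open Scope ring_scope.

(** * Real-valued norms and closed spans *)

Section real_norm.
Context {R : realType}.
Implicit Type V : normedModType R[i].

(** Norms take values in the partially ordered [R[i]]; real parts move every estimate into [R],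
    where [lra] and [nra] apply. *)
Definition rnorm {V} (x : V) : R := complex.Re `|x|.

Lemma rnormE {V} (x : V) : `|x| = (rnorm x)%:C%C.
Proof. by rewrite /rnorm RRe_real // ger0_real. Qed.

Lemma Re_add (a b : R[i]) : complex.Re (a + b) = complex.Re a + complex.Re b.
Proof. by case: a; case: b. Qed.

Lemma Re_le (a b : R[i]) : a <= b -> complex.Re a <= complex.Re b.
Proof. by rewrite lecE => /andP[]. Qed.

Lemma Re_realM (a : R) (b : R[i]) :
  complex.Re (a%:C%C * b) = a * complex.Re b.
Proof. by case: b => b1 b2 /=; rewrite mul0r subr0. Qed.

Lemma rnorm_ge0 {V} (x : V) : 0 <= rnorm x.
Proof. by have := normr_ge0 x; rewrite rnormE ler0c. Qed.

Lemma rnorm0 {V} : rnorm (0 : V) = 0.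
Proof. by rewrite /rnorm normr0. Qed.

Lemma rnorm_eq0 {V} (x : V) : rnorm x = 0 -> x = 0.
Proof. by move=> x0; apply/eqP; rewrite -normr_eq0 rnormE x0. Qed.

Lemma rnormN {V} (x : V) : rnorm (- x) = rnorm x.
Proof. by rewrite /rnorm normrN. Qed.

Lemma rnormD {V} (x y : V) : rnorm (x + y) <= rnorm x + rnorm y.
Proof. by rewrite -Re_add; apply/Re_le/ler_normD. Qed.

Lemma rnormB {V} (x y : V) : rnorm (x - y) <= rnorm x + rnorm y.
Proof. by rewrite -(rnormN y); exact: rnormD. Qed.

Lemma rdistC {V} (x y : V) : rnorm (x - y) = rnorm (y - x).
Proof. by rewrite -rnormN opprB. Qed.

Lemma rdistD {V} (y x z : V) : rnorm (x - z) <= rnorm (x - y) + rnorm (y - z).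
Proof. by rewrite -[x - z](subrKA y); exact: rnormD. Qed.

Lemma rnormZ {V} (c : R[i]) (x : V) :
  rnorm (c *: x) = complex.Re `|c| * rnorm x.
Proof. by rewrite /rnorm normrZ -[`|c|]RRe_real ?ger0_real // Re_realM. Qed.

Lemma Re_norm_ge0 (c : R[i]) : 0 <= complex.Re `|c|.
Proof. by rewrite -ler0c RRe_real ?ger0_real. Qed.

Lemma Re_norm_real (t : R) : complex.Re `|t%:C%C| = `|t|.
Proof. by rewrite normc_def /= expr0n addr0 sqrtr_sqr. Qed.

Lemma rnormZr {V} (t : R) (x : V) : rnorm (t%:C%C *: x) = `|t| * rnorm x.
Proof. by rewrite rnormZ Re_norm_real. Qed.

Lemma nbhs_rnorm {V} (x : V) (B : set V) :
  nbhs x B <-> exists2 e : R, 0 < e & forall y, rnorm (x - y) < e -> B y.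
Proof.
rewrite nbhs_ballP; split => [[e /= e0 eB]|[e e0 eB]].
  have eE : e = (complex.Re e)%:C%C by rewrite RRe_real // ger0_real // ltW.
  exists (complex.Re e); first by rewrite -ltcR -eE.
  by move=> y xy; apply: eB; rewrite -ball_normE /= rnormE eE ltcR.
exists e%:C%C => /=; first by rewrite ltcR.
by move=> y; rewrite -ball_normE /= rnormE ltcR; exact: eB.
Qed.

Lemma closed_rnorm {V} (K : set V) :
  closed K <->
  forall x, (forall e, 0 < e -> exists2 y, K y & rnorm (x - y) < e) -> K x.
Proof.
split=> [cK x xK|cK x xK].
  apply: cK => B /nbhs_rnorm[e e0 eB]; have [y Ky xy] := xK e e0.
  by exists y; split => //; exact: eB.
apply: cK => e e0; have [|y [Ky xy]] := xK [set y | rnorm (x - y) < e].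
  by apply/nbhs_rnorm; exists e.
by exists y.
Qed.

Definition rcvg {V} (u : nat -> V) (l : V) :=
  forall e, 0 < e -> exists N, forall n, (N <= n)%N -> rnorm (u n - l) < e.

Lemma rcauchy_cvg (V : completeNormedModType R[i]) (u : nat -> V) :
  (forall e, 0 < e ->
    exists N, forall m n, (N <= m)%N -> (N <= n)%N -> rnorm (u m - u n) < e) ->
  exists l, rcvg u l.
Proof.
move=> cu.
have /cauchy_cvg cvu : cauchy (u @ \oo).
  apply/cauchy_exP => e e0.
  have eE : e = (complex.Re e)%:C%C by rewrite RRe_real // ger0_real // ltW.
  have [|N uN] := cu (complex.Re e); first by rewrite -ltcR -eE.
  exists (u N), N => // n /= Nn.
  by rewrite -ball_normE /= rnormE eE ltcR uN.
exists (lim (u @ \oo)) => e e0.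
have /cvgrPdist_lt/(_ e%:C%C) := cvu; rewrite ltcR => /(_ e0)[N _ NP].
by exists N => n Nn; have := NP n Nn; rewrite rnormE ltcR rdistC.
Qed.

End real_norm.

Section subspaces.
Context {R : realType}.
Implicit Types U V : normedModType R[i].

Section linear_maps.
Context {U V : lmodType R[i]} (f : U -> V).
Hypothesis lf : linear f.

Lemma linear0_of : f 0 = 0.
Proof.
have := lf 1 0 0; rewrite !scale1r !addr0 => /eqP.
by rewrite -subr_eq0 opprD addNKr oppr_eq0 => /eqP.
Qed.

Lemma linearZ_of c x : f (c *: x) = c *: f x.
Proof. by rewrite -[c *: x]addr0 lf linear0_of addr0. Qed.

Lemma linearD_of x y : f (x + y) = f x + f y.
Proof. by rewrite -[x]scale1r lf !scale1r. Qed.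

Lemma linearN_of x : f (- x) = - f x.
Proof. by rewrite -scaleN1r linearZ_of scaleN1r. Qed.

Lemma linearB_of x y : f (x - y) = f x - f y.
Proof. by rewrite linearD_of linearN_of. Qed.

Lemma linear_sum_of (I : Type) (s : seq I) (F : I -> U) :
  f (\sum_(i <- s) F i) = \sum_(i <- s) f (F i).
Proof.
elim: s => [|i s IH]; first by rewrite !big_nil linear0_of.
by rewrite !big_cons linearD_of IH.
Qed.

End linear_maps.

Lemma bounded_rnorm {U V} (f : U -> V) :
  bounded_operator f <->
  linear f /\ exists2 M, 0 < M & forall u, rnorm (f u) <= M * rnorm u.
Proof.
split=> [[lf [M fM]]|[lf [M M0 fM]]]; split=> //; last first.
  exists M%:C%C => u; rewrite !rnormE.
  by rewrite -(rmorphM (real_complex R)) lecR; exact: fM.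
exists (`|complex.Re M| + 1); first by rewrite ltr_wpDl.
move=> u; have := Re_le (fM u); rewrite mulrC [in X in _ -> X]mulrC.
rewrite [`|u|]rnormE Re_realM => /le_trans; apply.
by rewrite ler_wpM2l ?rnorm_ge0 // ler_wpDr ?ler_norm.
Qed.

Lemma closed_subspaceP {V} {K : set V} : closed_subspace K ->
  [/\ K 0, forall x y, K x -> K y -> K (x + y),
     forall c x, K x -> K (c *: x) & forall x y, K x -> K y -> K (x - y)].
Proof.
case=> _ K0 KD.
have KZ c x : K x -> K (c *: x) by move=> Kx; rewrite -[_ *: _]addr0; exact: KD.
split=> // x y Kx Ky; first by rewrite -[x]scale1r; exact: KD.
by rewrite addrC -scaleN1r; exact: KD.
Qed.

Lemma closed_subspace_sum {V} {K : set V} (I : Type) (s : seq I) (F : I -> V) :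
  closed_subspace K -> (forall i, K (F i)) -> K (\sum_(i <- s) F i).
Proof.
move=> /closed_subspaceP[K0 KD _ _] KF; elim: s => [|i s IH].
  by rewrite big_nil.
by rewrite big_cons; exact: KD.
Qed.

Lemma closed_subspace_preimage {U V} (f : U -> V) (K : set V) :
  bounded_operator f -> closed_subspace K ->
  closed_subspace [set x | K (f x)].
Proof.
move=> /bounded_rnorm[lf [M M0 fM]] [cK K0 KD]; split => /=.
- apply/closed_rnorm => x xK; apply: (iffLR (closed_rnorm K) cK) => e e0.
  have [y Ky xy] := xK (e / M) (divr_gt0 e0 M0).
  exists (f y) => //; rewrite -linearB_of //; apply: le_lt_trans (fM _) _.
  by rewrite mulrC -ltr_pdivlMr.
- by rewrite linear0_of.
- by move=> c x y Kx Ky; rewrite lf; exact: KD.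
Qed.

Lemma closed_subspace0 V : closed_subspace [set 0 : V].
Proof.
split=> //= [|c x y -> ->]; last by rewrite scaler0 addr0.
apply/closed_rnorm => x x0; apply: rnorm_eq0; apply: contrapT => /eqP xN0.
have [|y /= -> ] := x0 (rnorm x); first by rewrite lt_def xN0 rnorm_ge0.
by rewrite subr0 ltxx.
Qed.

Lemma bounded_operatorB {U V} (f g : U -> V) :
  bounded_operator f -> bounded_operator g ->
  bounded_operator (fun x => f x - g x).
Proof.
move=> /bounded_rnorm[lf [M M0 fM]] /bounded_rnorm[lg [N N0 gN]].
apply/bounded_rnorm; split.
  by move=> c x y; rewrite lf lg scalerBr opprD addrACA.
exists (M + N); first exact: addr_gt0.
move=> u; apply: le_trans (rnormB _ _) _.
by rewrite mulrDl lerD.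
Qed.

Lemma bounded_operator_comp {U V} {W : normedModType R[i]}
    (f : U -> V) (g : V -> W) :
  bounded_operator f -> bounded_operator g -> bounded_operator (g \o f).
Proof.
move=> /bounded_rnorm[lf [M M0 fM]] /bounded_rnorm[lg [N N0 gN]].
apply/bounded_rnorm; split; first by move=> c x y /=; rewrite lf lg.
exists (N * M); first exact: mulr_gt0.
move=> u /=; apply: le_trans (gN _) _.
by rewrite -mulrA ler_pM2l.
Qed.

Lemma bounded_operator_id {U} : bounded_operator (@idfun U).
Proof.
by apply/bounded_rnorm; split=> //; exists 1 => // u; rewrite mul1r.
Qed.

Lemma closed_subspace_eqlocus {U V} (f g : U -> V) :
  bounded_operator f -> bounded_operator g ->
  closed_subspace [set x | f x = g x].
Proof.
move=> bf bg.
have -> : [set x | f x = g x] = [set x | [set 0 : V] (f x - g x)].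
  by apply/seteqP; split=> x /= => [->|/eqP]; rewrite ?subrr // subr_eq0 => /eqP.
by apply: closed_subspace_preimage (closed_subspace0 _); exact: bounded_operatorB.
Qed.

Lemma sub_closed_span {V} (S : set V) : S `<=` closed_span S.
Proof. exact: sub_smallest. Qed.

Lemma closed_span_min {V} (S K : set V) :
  closed_subspace K -> S `<=` K -> closed_span S `<=` K.
Proof. by move=> cK SK; exact: smallest_sub. Qed.

Lemma closed_span_closed {V} (S : set V) : closed_subspace (closed_span S).
Proof.
split.
- apply/closed_rnorm => x xS K [cK SK]; have [cK' _ _] := cK.
  apply: (iffLR (closed_rnorm K) cK') => e /xS[y yS xy].
  by exists y => //; exact: yS.
- by move=> K [[]].
- move=> c x y xS yS K KP; have [[_ _ KD] _] := KP.
  by apply: KD; [apply: xS|apply: yS].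
Qed.

Lemma closed_spanS {V} (S S' : set V) :
  S `<=` closed_span S' -> closed_span S `<=` closed_span S'.
Proof. by apply: closed_span_min; exact: closed_span_closed. Qed.

Lemma closed_span_image {U V} (f : U -> V) (S : set U) (S' : set V) :
  bounded_operator f -> (forall x, S x -> closed_span S' (f x)) ->
  forall x, closed_span S x -> closed_span S' (f x).
Proof.
move=> bf fS x xS.
have cS := closed_subspace_preimage bf (closed_span_closed S').
exact: (closed_span_min cS fS).
Qed.

Lemma eq_on_total {U V} (S : set U) (f g : U -> V) :
  closed_span S = setT -> bounded_operator f -> bounded_operator g ->
  (forall x, S x -> f x = g x) -> f = g.
Proof.
move=> St bf bg fg; apply/funext => x.
have xS : closed_span S x by rewrite St.
exact: (closed_span_min (closed_subspace_eqlocus bf bg) fg).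
Qed.

Definition lincomb {V} (I : Type) (a : I -> V) (s : seq (R[i] * I)) : V :=
  \sum_(p <- s) p.1 *: a p.2.

Lemma lincombZD {V} (I : Type) (a : I -> V) c (s t : seq (R[i] * I)) :
  lincomb a ([seq (c * p.1, p.2) | p <- s] ++ t)
    = c *: lincomb a s + lincomb a t.
Proof.
rewrite /lincomb big_cat big_map /= scaler_sumr; congr (_ + _).
by apply: eq_bigr => p _; rewrite scalerA.
Qed.

(** [closed_span] is an intersection and yields no approximants by itself; the vectors that have
    them form a closed subspace containing [S]. *)
Lemma closed_span_approx {V} (I : Type) (a : I -> V) (S : set V) (x : V) :
  S `<=` range a -> closed_span S x ->
  forall e, 0 < e -> exists s, rnorm (x - lincomb a s) < e.
Proof.
move=> Sa; pose A x := forall e, 0 < e -> exists s, rnorm (x - lincomb a s) < e.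
suff : closed_span S `<=` A by apply.
apply: closed_span_min => [|y /Sa[i _ <-] e e0]; last first.
  by exists [:: (1, i)]; rewrite /lincomb big_seq1 scale1r subrr rnorm0.
split.
- apply/closed_rnorm => y yA e e0.
  have e2 : 0 < e / 2 by lra.
  have [z Az yz] := yA _ e2; have [s zs] := Az _ e2.
  by exists s; apply: le_lt_trans (rdistD z _ _) _; lra.
- by move=> e e0; exists [::]; rewrite /lincomb big_nil subr0 rnorm0.
- move=> c y z Ay Az e e0; set C := complex.Re `|c|.
  have C0 : 0 <= C := Re_norm_ge0 c.
  have [|s ys] := Ay (e / 2 / (C + 1)); first by apply: divr_gt0; lra.
  have [|t zt] := Az (e / 2); first by lra.
  exists ([seq (c * p.1, p.2) | p <- s] ++ t).
  rewrite lincombZD opprD addrACA -scalerBr.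
  apply: le_lt_trans (rnormD _ _) _; rewrite rnormZ -/C.
  have : C * rnorm (y - lincomb a s) <= e / 2.
    move: ys; rewrite ltr_pdivlMr; last by lra.
    have := rnorm_ge0 (y - lincomb a s); nra.
  lra.
Qed.

Lemma rnorm_small {V} (x : V) : (forall e, 0 < e -> rnorm x <= e) -> x = 0.
Proof.
move=> x0; apply: rnorm_eq0; apply/eqP; rewrite eq_le rnorm_ge0 andbT.
by apply/ler_addgt0Pr => e /x0; rewrite add0r.
Qed.

(** A combination of images is the image of one vector of [K], because [K] is a subspace. *)
Lemma closed_span_image_approx {U V} (f : U -> V) (K : set U) (x : V) :
  linear f -> closed_subspace K -> closed_span (f @` K) x ->
  forall e, 0 < e -> exists2 u, K u & rnorm (x - f u) < e.
Proof.
move=> lf cK xK e e0.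
have sub : f @` K `<=` range (fun u : {u | K u} => f (sval u)).
  by move=> _ [u Ku <-]; exists (exist _ u Ku).
have [s xs] := closed_span_approx sub xK e0.
exists (lincomb sval s).
  apply: closed_subspace_sum => // p.
  by have [_ _ KZ _] := closed_subspaceP cK; apply/KZ/svalP.
suff -> : f (lincomb sval s) = lincomb (f \o sval) s by [].
by rewrite /lincomb (linear_sum_of lf); apply: eq_bigr => p _; exact: linearZ_of.
Qed.

End subspaces.

(** * Inner products and their real parts *)

Section hilbert.
Context {R : realType}.
Implicit Types H : hilbertType R.

Lemma hdotDl {H} (h h' k : H) : hdot (h + h') k = hdot h k + hdot h' k.
Proof. exact: linearDl. Qed.

Lemma hdotZl {H} c (h k : H) : hdot (c *: h) k = c * hdot h k.
Proof. exact: linearZl_LR. Qed.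

Lemma hdotC {H} (h k : H) : hdot h k = (hdot k h)^*.
Proof. by rewrite hermC expr0 mul1r. Qed.

Lemma hdotDr {H} (h k k' : H) : hdot h (k + k') = hdot h k + hdot h k'.
Proof. exact: linearDr. Qed.

Lemma hdotZr {H} c (h k : H) : hdot h (c *: k) = c^* * hdot h k.
Proof. exact: linearZr_LR. Qed.

Lemma hdotBl {H} (h h' k : H) : hdot (h - h') k = hdot h k - hdot h' k.
Proof. exact: linearBl. Qed.

Lemma hdotBr {H} (k h h' : H) : hdot k (h - h') = hdot k h - hdot k h'.
Proof. exact: linearBr. Qed.

Lemma hdot0r {H} (h : H) : hdot h 0 = 0. Proof. exact: linear0r. Qed.

Definition rdot {H} (h k : H) : R := complex.Re (hdot h k).

Lemma rdotC {H} (h k : H) : rdot h k = rdot k h.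
Proof. by rewrite /rdot hdotC; case: (hdot k h). Qed.

Lemma rdotDl {H} (h h' k : H) : rdot (h + h') k = rdot h k + rdot h' k.
Proof. by rewrite /rdot hdotDl Re_add. Qed.

Lemma rdotDr {H} (h k k' : H) : rdot h (k + k') = rdot h k + rdot h k'.
Proof. by rewrite rdotC rdotDl !(rdotC h). Qed.

Lemma rdotZl {H} (t : R) (h k : H) : rdot (t%:C%C *: h) k = t * rdot h k.
Proof. by rewrite /rdot hdotZl Re_realM. Qed.

Lemma rdotNl {H} (h k : H) : rdot (- h) k = - rdot h k.
Proof. by rewrite -scaleN1r -(rmorphN1 (real_complex R)) rdotZl mulN1r. Qed.

Lemma rdotBl {H} (h h' k : H) : rdot (h - h') k = rdot h k - rdot h' k.
Proof. by rewrite rdotDl rdotNl. Qed.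

Lemma rdotBr {H} (k h h' : H) : rdot k (h - h') = rdot k h - rdot k h'.
Proof. by rewrite rdotC rdotBl !(rdotC k). Qed.

Lemma rdot0l {H} (k : H) : rdot 0 k = 0.
Proof. by have := rdotDl 0 0 k; rewrite addr0 => ?; lra. Qed.

Lemma rdot_rnorm {H} (h : H) : rdot h h = rnorm h ^+ 2.
Proof. by rewrite /rdot -hdot_norm rnormE -(rmorphXn (real_complex R)). Qed.

Lemma rdot_ge0 {H} (h : H) : 0 <= rdot h h.
Proof. by rewrite rdot_rnorm sqr_ge0. Qed.

Lemma rdot_eq0 {H} (h : H) : rdot h h = 0 -> h = 0.
Proof. by rewrite rdot_rnorm => /eqP; rewrite sqrf_eq0 => /eqP/rnorm_eq0. Qed.

Lemma rnorm_sqrD {H} (h k : H) :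
  rnorm (h + k) ^+ 2 = rnorm h ^+ 2 + rnorm k ^+ 2 + 2 * rdot h k.
Proof. by rewrite -!rdot_rnorm !(rdotDl, rdotDr) (rdotC k h); lra. Qed.

Lemma rnorm_sqrB {H} (h k : H) :
  rnorm (h - k) ^+ 2 = rnorm h ^+ 2 + rnorm k ^+ 2 - 2 * rdot h k.
Proof. by rewrite -!rdot_rnorm !(rdotBl, rdotBr) (rdotC k h); lra. Qed.

Lemma rdot_CauchySchwarz {H} (h k : H) : rdot h k <= rnorm h * rnorm k.
Proof.
have [->|hN0] := eqVneq h 0; first by rewrite rdot0l rnorm0 mul0r.
have [->|kN0] := eqVneq k 0; first by rewrite rdotC rdot0l rnorm0 mulr0.
have rnorm_gt0 (x : H) : x != 0 -> 0 < rnorm x.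
  by move=> xN0; rewrite lt_def rnorm_ge0 andbT; apply: contraNneq xN0 => /rnorm_eq0->.
have [h0 k0] := (rnorm_gt0 _ hN0, rnorm_gt0 _ kN0).
have := sqr_ge0 (rnorm ((rnorm k)%:C%C *: h - (rnorm h)%:C%C *: k)).
rewrite rnorm_sqrB !rnormZr !gtr0_norm // rdotZl rdotC rdotZl rdotC.
move=> ineq; rewrite -subr_ge0 -(pmulr_rge0 _ (mulr_gt0 h0 k0)); nra.
Qed.

(** Taking [c = 1] and [c = 'i] recovers both components, so complex identities follow from real
    ones. *)
Lemma hdot_eq {H1 H2 : hilbertType R} (h k : H1) (h' k' : H2) :
  (forall c, rdot (c *: h) k = rdot (c *: h') k') -> hdot h k = hdot h' k'.
Proof.
move=> hk; have := hk 1; have := hk 'i%C; rewrite /rdot !hdotZl !mul1r.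
case: (hdot h k) => a b; case: (hdot h' k') => a' b' /=.
by rewrite !mul0r !mul1r !sub0r => /oppr_inj -> ->.
Qed.

End hilbert.

(** * Projections and adjoints *)

Section projection.
Context {R : realType}.
Implicit Types H : hilbertType R.

Lemma invSn_lt (e : R) : 0 < e ->
  exists N, forall n, (N <= n)%N -> (n.+1%:R : R)^-1 < e.
Proof.
move=> e0; exists (Num.truncn e^-1) => n Nn.
rewrite invf_plt ?posrE ?ltr0n //; apply: lt_le_trans (truncnS_gt _) _.
by rewrite ler_nat.
Qed.

Lemma parallelogram {H} (h k : H) :
  rnorm (h + k) ^+ 2 + rnorm (h - k) ^+ 2
    = 2 * rnorm h ^+ 2 + 2 * rnorm k ^+ 2.
Proof. by rewrite rnorm_sqrD rnorm_sqrB; ring. Qed.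

(** A minimizing sequence is Cauchy by the parallelogram law, since midpoints stay in [K] and have
    distance at least [d] from [h]. *)
Lemma dist_argmin {H} (K : set H) (h : H) : closed_subspace K ->
  exists2 p, K p & forall k, K k -> rnorm (h - p) <= rnorm (h - k).
Proof.
move=> cK; have [K0 KD KZ KB] := closed_subspaceP cK.
pose D := [set rnorm (h - k) | k in K].
have D0 : has_inf D.
  split; first by exists (rnorm (h - 0)), 0.
  by exists 0 => _ [k Kk <-]; exact: rnorm_ge0.
pose d := inf D.
have dD k : K k -> d <= rnorm (h - k).
  by move=> Kk; apply: ge_inf; [exact: D0.2|exists k].
have d0 : 0 <= d by apply: lb_le_inf; [exact: D0.1|move=> _ [k Kk <-]; exact: rnorm_ge0].
have /choice[u uP] n : exists k, K k /\ rnorm (h - k) < d + n.+1%:R^-1.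
  have n0 : 0 < n.+1%:R^-1 :> R by rewrite invr_gt0 ltr0n.
  by have [_ [k Kk <-] ?] := inf_adherent n0 D0; exists k.
(* With a = 1/(N+1) the parallelogram law leaves 4(d + a)^2 - 4d^2 = 8da + 4a^2, and a <= 1. *)
have umn N m n : (N <= m)%N -> (N <= n)%N ->
    rnorm (u m - u n) ^+ 2 <= (8 * d + 4) * N.+1%:R^-1.
  move=> Nm Nn; have [Km um] := uP m; have [Kn un] := uP n.
  have uN k : (N <= k)%N -> k.+1%:R^-1 <= N.+1%:R^-1 :> R.
    by move=> Nk; rewrite lef_pV2 ?posrE ?ltr0n // ler_nat.
  set a : R := N.+1%:R^-1.
  have a0 : 0 < a by rewrite invr_gt0 ltr0n.
  have a1 : a <= 1 by rewrite invf_le1 ?ltr0n // ler1n.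
  have := parallelogram (h - u n) (h - u m).
  have -> : h - u n - (h - u m) = u m - u n by rewrite opprB addrC addrA addrNK.
  have -> : h - u n + (h - u m)
      = (2 : R)%:C%C *: (h - (2^-1 : R)%:C%C *: (u m + u n)).
    rewrite scalerBr scalerA -(rmorphM (real_complex R)) divff ?pnatr_eq0 //.
    rewrite scale1r rmorphD rmorph1 scalerDl scale1r opprD addrACA.
    by rewrite [- u n - u m]addrC.
  rewrite rnormZr ger0_norm //.
  have := dD _ (KZ (2^-1 : R)%:C%C _ (KD _ _ Km Kn)).
  have {um} : rnorm (h - u m) <= d + a by apply: le_trans (ltW um) _; rewrite lerD2l uN.
  have {un} : rnorm (h - u n) <= d + a by apply: le_trans (ltW un) _; rewrite lerD2l uN.
  have := rnorm_ge0 (h - u n); have := rnorm_ge0 (h - u m).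
  set x := rnorm (h - u m); set y := rnorm (h - u n); set z := rnorm (h - _).
  set w := rnorm (_ - _) => x0 y0 yd xd dz E.
  have : x ^+ 2 <= (d + a) ^+ 2 by rewrite ler_sqr ?nnegrE // addr_ge0 // ltW.
  have : y ^+ 2 <= (d + a) ^+ 2 by rewrite ler_sqr ?nnegrE // addr_ge0 // ltW.
  have : d ^+ 2 <= z ^+ 2 by rewrite ler_sqr ?nnegrE // (le_trans d0).
  have : a ^+ 2 <= a by rewrite expr2 ler_piMl // ltW.
  nra.
have [e e0|p up] := rcauchy_cvg (u := u).
  have [|N NP] := @invSn_lt (e ^+ 2 / (8 * d + 4)).
    by apply: divr_gt0; [rewrite exprn_gt0|lra].
  exists N => m n Nm Nn; rewrite -ltr_sqr ?nnegrE ?rnorm_ge0 ?ltW //.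
  apply: le_lt_trans (umn _ _ _ Nm Nn) _.
  by rewrite mulrC -ltr_pdivlMr; [exact: NP|lra].
have Kp : K p.
  have [cK' _ _] := cK; apply: (iffLR (closed_rnorm K) cK') => e /up[N NP].
  by exists (u N); [exact: (uP N).1|rewrite rdistC; exact: NP].
exists p => // k Kk; apply/ler_addgt0Pr => e e0.
have e2 : 0 < e / 2 by lra.
have [N NP] := up _ e2; have [M MP] := invSn_lt e2.
have := NP (maxn N M) (leq_maxl _ _); have := MP (maxn N M) (leq_maxr _ _).
set a := (maxn N M).+1%:R^-1; have [_] := uP (maxn N M); rewrite -/a; have := dD _ Kk.
have := rdistD (u (maxn N M)) h p; lra.
Qed.

Lemma projection {H} (K : set H) (h : H) : closed_subspace K ->
  exists2 p, K p & forall k, K k -> hdot (h - p) k = 0.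
Proof.
move=> cK; have [K0 KD KZ KB] := closed_subspaceP cK.
have [p Kp pmin] := dist_argmin h cK; exists p => // k Kk.
have rdot0 k' : K k' -> rdot (h - p) k' = 0.
  move=> Kk'; set r := rdot _ _.
  have ineq t : 2 * t * r <= t ^+ 2 * rnorm k' ^+ 2.
    have := pmin _ (KD _ _ Kp (KZ t%:C%C _ Kk')).
    rewrite opprD addrA -ler_sqr ?nnegrE ?rnorm_ge0 // [leRHS]rnorm_sqrB.
    rewrite rnormZr exprMn real_normK ?num_real // rdotC rdotZl rdotC -/r; lra.
  have q0 := sqr_ge0 (rnorm k'); set q := rnorm k' ^+ 2 in ineq q0.
  (* Since r = s(q + 1), the inequality at t = s becomes s^2 (q + 2) <= 0. The [+ 1] covers
     [q = 0]. *)
  have := ineq (r / (q + 1)); set s := r / (q + 1).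
  have -> : r = s * (q + 1) by rewrite divfK //; lra.
  move=> ineq'; have : s ^+ 2 <= 0 by nra.
  by rewrite real_exprn_even_le0 ?num_real //= => /eqP ->; rewrite mul0r.
rewrite -(hdot0r (0 : H)); apply: hdot_eq => c.
rewrite scaler0 rdot0l -(rdot0 (c^* *: k)); last exact: KZ.
by rewrite /rdot hdotZl hdotZr conjCK.
Qed.

Lemma closed_subspace_orth {H} (S : set H) :
  closed_subspace [set h | forall s, S s -> hdot h s = 0].
Proof.
split=> /=.
- apply/closed_rnorm => h hS s Ss.
  rewrite -(hdot0r (0 : H)); apply: hdot_eq => c; rewrite scaler0 rdot0l.
  apply/eqP; rewrite -normr_le0; apply/ler_addgt0Pr => e e0; rewrite add0r.
  pose C := (complex.Re `|c| + 1) * (rnorm s + 1).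
  have C1 : 0 < complex.Re `|c| + 1 by have := Re_norm_ge0 c; lra.
  have C2 : 0 < rnorm s + 1 by have := rnorm_ge0 s; lra.
  have C0 : 0 < C by exact: mulr_gt0.
  have [k hk] := hS (e / C) (divr_gt0 e0 C0); rewrite ltr_pdivlMr // => hkC.
  have {hkC} : rnorm (c *: (h - k)) * rnorm s <= e.
    apply: le_trans (ltW hkC); rewrite rnormZ /C mulrCA -[leRHS]mulrCA.
    rewrite [complex.Re _ * _]mulrC -mulrA ler_wpM2l ?rnorm_ge0 //.
    by apply: ler_pM; rewrite ?rnorm_ge0 ?Re_norm_ge0 ?lerDl.
  have -> : rdot (c *: h) s = rdot (c *: (h - k)) s.
    by rewrite /rdot !hdotZl hdotBl (hk _ Ss) subr0.
  move=> le_e; rewrite ler_norml.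
  have := rdot_CauchySchwarz (c *: (h - k)) s.
  have := rdot_CauchySchwarz (- (c *: (h - k))) s; rewrite rnormN rdotNl; lra.
- by move=> s _; rewrite -[0](scale0r s) hdotZl mul0r.
- by move=> c h k hS kS s Ss; rewrite hdotDl hdotZl hS // kS // mulr0 addr0.
Qed.

Lemma closed_subspace_full {H} (K : set H) : closed_subspace K ->
  (forall h, (forall k, K k -> hdot h k = 0) -> h = 0) -> K = setT.
Proof.
move=> cK K0; apply/seteqP; split=> // h _.
have [p Kp hp] := projection h cK.
by have /eqP := K0 _ hp; rewrite subr_eq0 => /eqP ->.
Qed.

Lemma hdot_eq0 {H} (h : H) : (hdot h h = 0) -> h = 0.
Proof. by move=> h0; apply: rdot_eq0; rewrite /rdot h0. Qed.

Lemma hdot_injr {H} (w w' : H) : (forall u, hdot u w = hdot u w') -> w = w'.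
Proof.
move=> ww'; apply/eqP; rewrite -subr_eq0; apply/eqP/hdot_eq0.
by rewrite [LHS]hdotBr ww' subrr.
Qed.

(** Riesz representation of the functional [u |-> hdot (f u) v]: unless it vanishes, a vector [z]
    orthogonal to its kernel represents it up to a scalar. *)
Lemma adjoint_exists {H H' : hilbertType R} (f : H -> H') (v : H') :
  bounded_operator f -> exists w, forall u, hdot (f u) v = hdot u w.
Proof.
move=> bf; have [lf _] := bf; pose K := [set u | hdot (f u) v = 0].
have cK : closed_subspace K.
  have -> : K = [set u | [set h | forall s, [set v] s -> hdot h s = 0] (f u)].
    by apply/seteqP; split=> u /= => [fu _ ->|]; [|exact].
  exact/closed_subspace_preimage/closed_subspace_orth.
have [KT|/eqP/negP K0] := pselect (K = setT).
  by exists 0 => u; rewrite hdot0r; have : K u by rewrite KT.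
have [u0 fu0] : exists u0, hdot (f u0) v <> 0.
  apply: contrapT => nex; apply/K0/eqP/seteqP; split=> // u _.
  by apply: contrapT => fu; apply: nex; exists u.
have [p Kp pK] := projection u0 cK; set z := u0 - p in pK.
have fz : hdot (f z) v != 0.
  by rewrite linearB_of // hdotBl Kp subr0; apply/eqP.
have zz : hdot z z != 0.
  apply: contraNneq fz => /hdot_eq0 ->.
  by rewrite linear0_of // -(scale0r 0) hdotZl mul0r.
exists (((hdot (f z) v) / (hdot z z))^* *: z) => u; rewrite hdotZr conjCK.
pose c := hdot (f u) v / hdot (f z) v.
have Ku : K (u - c *: z).
  by rewrite /K /= linearB_of // linearZ_of // hdotBl hdotZl divfK // subrr.
have := pK _ Ku; rewrite hdotC hdotBl hdotZl => /(congr1 Num.conj).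
rewrite conjCK rmorph0 => /eqP; rewrite subr_eq0 => /eqP ->.
by rewrite mulrC -mulrA [hdot z z * _]mulrC divfK // /c divfK.
Qed.

Lemma adjointP {H H' : hilbertType R} (f : H -> H') :
  bounded_operator f -> forall u v, hdot (f u) v = hdot u (adjoint f v).
Proof.
move=> bf; rewrite /adjoint; case: xgetP => [_ -> //|] noadj.
have /choice[g gP] v := adjoint_exists v bf.
by have [] := noadj g; move=> u v; exact: gP.
Qed.

Lemma adjoint_rdot {H H' : hilbertType R} (f : H -> H') :
  bounded_operator f -> forall u v, rdot (f u) v = rdot u (adjoint f v).
Proof. by move=> bf u v; rewrite /rdot adjointP. Qed.

Lemma adjoint_bounded {H H' : hilbertType R} (f : H -> H') :
  bounded_operator f -> bounded_operator (adjoint f).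
Proof.
move=> bf; have [lf [M M0 fM]] := iffLR (bounded_rnorm f) bf.
apply/bounded_rnorm; split=> [c v w|].
  apply: hdot_injr => u.
  by rewrite hdotDr hdotZr -!adjointP // hdotDr hdotZr.
exists M => // v; set a := rnorm (adjoint f v).
have a0 : 0 <= a := rnorm_ge0 _; have [->|aN0] := eqVneq a 0.
  by rewrite mulr_ge0 ?rnorm_ge0 // ltW.
have a_gt0 : 0 < a by rewrite lt_def aN0.
rewrite -(ler_pM2l a_gt0) -expr2 -rdot_rnorm -adjoint_rdot //.
apply: le_trans (rdot_CauchySchwarz _ _) _.
by rewrite mulrCA mulrA ler_wpM2r ?rnorm_ge0.
Qed.

End projection.

(** * Bounded extensions and square roots *)

Section extension.
Context {R : realType} {U : normedModType R[i]} {V : completeNormedModType R[i]}.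

(** The bound makes the assignment well defined on combinations of the [a i], and completeness of
    [V] extends it to limits. *)
Lemma extend_total (I : Type) (a : I -> U) (b : I -> V) (S : set U) (M : R) :
  closed_span S = setT -> S `<=` range a -> 0 < M ->
  (forall s, rnorm (lincomb b s) <= M * rnorm (lincomb a s)) ->
  exists2 f : U -> V, bounded_operator f & forall i, f (a i) = b i.
Proof.
move=> St Sa M0 bM.
have bMB s t : rnorm (lincomb b s - lincomb b t)
    <= M * rnorm (lincomb a s - lincomb a t).
  have := bM ([seq (-1 * p.1, p.2) | p <- t] ++ s).
  by rewrite !lincombZD !scaleN1r ![- _ + _]addrC.
have approx x e : 0 < e -> exists s, rnorm (x - lincomb a s) < e.
  by move=> e0; apply: closed_span_approx Sa _ _ e0; rewrite St.
clear St.
(* Holding for all [s], this inequality pins down the value at [x]: the empty list then gives the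
   bound, a singleton the values on [a], a concatenation the linearity. *)
have lim_exists x : exists y, forall s,
    rnorm (y - lincomb b s) <= M * rnorm (x - lincomb a s).
  have /choice[s sP] n : exists s, rnorm (x - lincomb a s) < n.+1%:R^-1.
    by apply: approx; rewrite invr_gt0 ltr0n.
  have [e e0|y yP] := rcauchy_cvg (u := lincomb b \o s).
    have [|N NP] := @invSn_lt _ (e / (2 * M)); first by apply: divr_gt0; lra.
    exists N => m n Nm Nn /=; apply: le_lt_trans (bMB _ _) _.
    have := sP m; have := sP n; have := NP _ Nm; have := NP _ Nn.
    have := rdistD x (lincomb a (s m)) (lincomb a (s n)).
    rewrite [rnorm (_ - x)]rdistC.
    set c : R := m.+1%:R^-1; set d : R := n.+1%:R^-1 => h1 h2 h3 h4 h5.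
    have : rnorm (lincomb a (s m) - lincomb a (s n)) < e / M.
      by have -> : e / M = e / (2 * M) + e / (2 * M); [field; lra|lra].
    by rewrite ltr_pdivlMr // mulrC.
  exists y => t; apply/ler_addgt0Pr => e e0.
  have [|N NP] := yP (e / 2); first by lra.
  have [|N' N'P] := @invSn_lt _ (e / (2 * M)); first by apply: divr_gt0; lra.
  have := NP _ (leq_maxl N N'); have := N'P _ (leq_maxr N N').
  set n := maxn N N'; set c : R := n.+1%:R^-1; rewrite /= rdistC => h1 h2.
  have := rdistD (lincomb b (s n)) y (lincomb b t).
  have := bMB (s n) t; have := rdistD x (lincomb a (s n)) (lincomb a t).
  rewrite [rnorm (_ - x)]rdistC; have := sP n; rewrite -/c.
  have : c * M < e / 2 by rewrite -ltr_pdivlMr // -mulrA -invfM.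
  nra.
have {lim_exists} [f fP] := choice lim_exists.
exists f => [|i]; last first.
  apply/eqP; rewrite -subr_eq0; apply/eqP/rnorm_eq0/eqP.
  rewrite eq_le rnorm_ge0 andbT; have := fP (a i) [:: (1, i)].
  by rewrite /lincomb !big_seq1 !scale1r subrr rnorm0 mulr0.
apply/bounded_rnorm; split=> [c x y|]; last first.
  exists M => // u; have := fP u [::].
  by rewrite /lincomb !big_nil !subr0.
apply/eqP; rewrite -subr_eq0; apply/eqP/rnorm_small => e e0.
set C := complex.Re `|c|; have C0 : 0 <= C := Re_norm_ge0 c.
pose d := e / (2 * M) / (C + 1).
have d0 : 0 < d by rewrite !divr_gt0 //; lra.
have [s xs] := approx x _ d0; have [t yt] := approx y _ d0.
have := fP (c *: x + y) ([seq (c * p.1, p.2) | p <- s] ++ t).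
have := fP x s; have := fP y t; rewrite !lincombZD.
set as_ := lincomb a s; set bs := lincomb b s.
set at_ := lincomb a t; set bt := lincomb b t => h1 h2 h3.
have h4 : rnorm (f (c *: x + y) - (c *: f x + f y))
   <= rnorm (f (c *: x + y) - (c *: bs + bt))
      + (C * rnorm (f x - bs) + rnorm (f y - bt)).
  apply: le_trans (rdistD (c *: bs + bt) _ _) _; rewrite lerD2l.
  rewrite rdistC opprD addrACA -scalerBr.
  by apply: le_trans (rnormD _ _) _; rewrite rnormZ.
have h5 : rnorm (c *: x + y - (c *: as_ + at_))
    <= C * rnorm (x - as_) + rnorm (y - at_).
  rewrite opprD addrACA -scalerBr.
  by apply: le_trans (rnormD _ _) _; rewrite rnormZ.
have h6 : 2 * M * ((C + 1) * d) = e by rewrite /d; field; lra.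
have h7 : C * rnorm (f x - bs) <= C * (M * rnorm (x - as_)) by rewrite ler_wpM2l.
have h8 : C * rnorm (x - as_) <= C * d by rewrite ler_wpM2l // ltW.
have h9 : M * rnorm (c *: x + y - (c *: as_ + at_))
   <= M * (C * rnorm (x - as_) + rnorm (y - at_)) by rewrite ler_wpM2l // ltW.
have h10 : M * (C * rnorm (x - as_)) <= M * (C * d) by rewrite ler_wpM2l // ltW.
have h11 : M * rnorm (y - at_) <= M * d by rewrite ler_wpM2l // ltW.
apply: le_trans h4 _; nra.
Qed.

End extension.

Section cstar.
Context {R : realType} {A : cstarAlgType R}.
Implicit Types a b c : A.

Lemma amulBl a b c : amul (a - b) c = amul a c - amul b c.
Proof. by rewrite addrC -scaleN1r amul_linearl scaleN1r addrC. Qed.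

Lemma amulBr a b c : amul c (a - b) = amul c a - amul c b.
Proof. by rewrite addrC -scaleN1r amul_linearr scaleN1r addrC. Qed.

Lemma astarB a b : astar (a - b) = astar a - astar b.
Proof.
by rewrite addrC -scaleN1r astar_antilinear rmorphN1 scaleN1r addrC.
Qed.

Lemma astar0 : astar (0 : A) = 0.
Proof. by rewrite -(subrr 0) astarB !subrr. Qed.

Lemma amul_rnorm a b : rnorm (amul a b) <= rnorm a * rnorm b.
Proof. by have := Re_le (amul_norm a b); rewrite [`|a|]rnormE Re_realM. Qed.

Lemma cstar_rnorm a : rnorm (amul (astar a) a) = rnorm a ^+ 2.
Proof. by rewrite /rnorm cstar_identity rnormE -(rmorphXn (real_complex R)). Qed.

Lemma astar_rnorm a : rnorm (astar a) = rnorm a.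
Proof.
suff le b : rnorm b <= rnorm (astar b).
  by apply: le_anti; rewrite le andbT -{2}(astarK a).
have [->|b0] := eqVneq (rnorm b) 0; first exact: rnorm_ge0.
have b_gt0 : 0 < rnorm b by rewrite lt_def b0 rnorm_ge0.
by rewrite -(ler_pM2r b_gt0) -expr2 -cstar_rnorm amul_rnorm.
Qed.

(* [c = 1 - sqrt (1 - a)], the fixed point of [c |-> (a + c^2) / 2], which is a
   contraction of the self-adjoint part of the ball of radius [1/2]. *)
Lemma sqrt_1B a : astar a = a -> rnorm a <= 3 / 4 ->
  exists2 c, astar c = c & c + c - amul c c = a.
Proof.
move=> a_sa a34; pose half : R[i] := (2^-1 : R)%:C%C.
have rnorm_half x : rnorm (half *: x : A) = rnorm x / 2.
  by rewrite rnormZr ger0_norm ?invr_ge0 // mulrC.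
pose F c := half *: (a + amul c c).
pose u n := iter n F 0.
(* The ball of radius 1/2 is invariant because (3/4 + 1/4)/2 = 1/2; this explains the bound 3/4 on
   [a]. *)
have u_half n : rnorm (u n) <= 1 / 2.
  elim: n => [|n IH] /=; first by rewrite rnorm0; lra.
  rewrite rnorm_half; have := rnormD a (amul (u n) (u n)).
  have := amul_rnorm (u n) (u n); have := rnorm_ge0 (u n); nra.
have u_sa n : astar (u n) = u n.
  elim: n => [|n IH] /=; first exact: astar0.
  rewrite /F -/(u n) -[half *: _]addr0 astar_antilinear astar0 !addr0.
  rewrite -{1}[a]scale1r astar_antilinear rmorph1 scale1r astarM IH a_sa.
  by congr (_ *: _); exact: conjc_real.
have F_contr c d : rnorm c <= 1 / 2 -> rnorm d <= 1 / 2 ->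
    rnorm (F c - F d) <= rnorm (c - d) / 2.
  move=> c2 d2; rewrite -scalerBr rnorm_half ler_wpM2r ?invr_ge0 //.
  have -> : a + amul c c - (a + amul d d) = amul c (c - d) + amul (c - d) d.
    by rewrite amulBl amulBr opprD addrACA subrr add0r subrKA.
  apply: le_trans (rnormD _ _) _.
  have := amul_rnorm c (c - d); have := amul_rnorm (c - d) d.
  have := rnorm_ge0 (c - d); nra.
have u_cauchy n m : rnorm (u (n + m)%N - u n) <= 2^-1 ^+ n.
  elim: n => [|n IH]; first by rewrite subr0 expr0; have := u_half m; rewrite add0n; lra.
  rewrite addSn /=; apply: le_trans (F_contr _ _ (u_half _) (u_half _)) _.
  by rewrite exprS mulrC ler_wpM2l ?invr_ge0.
have pow_small e : 0 < e -> exists N, forall n, (N <= n)%N -> 2^-1 ^+ n < e :> R.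
  move=> /(@invSn_lt R)[N NP]; exists N => n /NP; apply: le_lt_trans.
  rewrite exprVn lef_pV2 ?posrE ?exprn_gt0 ?ltr0n //.
  by rewrite -natrX ler_nat ltn_expl.
have [e e0|c uc] := rcauchy_cvg (u := u).
  have [|N NP] := pow_small (e / 2); first by lra.
  exists N => m n /subnKC <- /subnKC <-.
  apply: le_lt_trans (rdistD (u N) _ _) _; rewrite [X in _ + X]rdistC.
  have := NP N (leqnn _); have := u_cauchy N (m - N)%N.
  have := u_cauchy N (n - N)%N; lra.
have c_half : rnorm c <= 1 / 2.
  apply/ler_addgt0Pr => e /uc[N /(_ _ (leqnn N))]; have := u_half N.
  have := rnormB (u N) (u N - c); rewrite opprB addrC addrNK; lra.
exists c.
  apply/eqP; rewrite -subr_eq0; apply/eqP/rnorm_small => e e0.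
  have [|N /(_ _ (leqnn N))] := uc (e / 2); first by lra.
  have := rdistD (u N) (astar c) c.
  by rewrite -{1}(u_sa N) -astarB astar_rnorm (rdistC c); lra.
have Fc : F c = c.
  apply/eqP; rewrite -subr_eq0; apply/eqP/rnorm_small => e e0.
  have [|N NP] := uc (e / 2); first by lra.
  have := NP N (leqnn _); have := NP N.+1 (leqnSn _) => /=.
  have := F_contr _ _ (u_half N) c_half.
  by have := rdistD (F (u N)) (F c) c; rewrite (rdistC (F c) (F (u N))); lra.
rewrite -{1 2}Fc /F -scalerDl -(rmorphD (real_complex R)).
rewrite (_ : 2^-1 + 2^-1 = 1 :> R); last by field.
by rewrite scale1r addrK.
Qed.

(** If t a = 2c - c^2, then formally 1 - t a = (1 - c)^2, so |w - p(c)|^2 = |w|^2 - t <p(a), w> is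
    nonnegative. Here [w] replaces the value of [p] at a unit, and t = 3/(4|a|) is the largest
    scaling that [sqrt_1B] permits. *)
Lemma state_le {H : hilbertType R} (p : A -> H) (w : H) :
  linear p -> (forall c, hdot (p c) (p c) = hdot (p (amul (astar c) c)) w) ->
  forall a, astar a = a -> rdot (p a) w <= 4 / 3 * rnorm a * rnorm w ^+ 2.
Proof.
move=> lp pp a a_sa.
have [a0|aN0] := eqVneq (rnorm a) 0.
  by rewrite (rnorm_eq0 a0) linear0_of // rdot0l rnorm0; lra.
have a_gt0 : 0 < rnorm a by rewrite lt_def aN0 rnorm_ge0.
pose t := 3 / 4 / rnorm a; have t0 : 0 < t by rewrite divr_gt0 //; lra.
have [||c c_sa cP] := @sqrt_1B (t%:C%C *: a).
- rewrite -[t%:C%C *: a]addr0 astar_antilinear astar0 a_sa.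
  by congr (_ *: _ + _); exact: conjc_real.
- by rewrite rnormZr gtr0_norm // divfK.
have := sqr_ge0 (rnorm (w - p c)); rewrite rnorm_sqrB -[rnorm (p c) ^+ 2]rdot_rnorm.
rewrite [rdot (p c) (p c)]/rdot pp c_sa -/(rdot _ _).
have := rdotZl t (p a) w.
rewrite -linearZ_of // -cP linearB_of // linearD_of // rdotBl rdotDl [rdot w _]rdotC.
move=> h1 h2; have : t * rdot (p a) w <= rnorm w ^+ 2 by lra.
rewrite mulrC -ler_pdivlMr // /t => /le_trans; apply.
by rewrite le_eqVlt; apply/orP; left; apply/eqP; field.
Qed.

(** The bound comes from positivity, so it applies where boundedness is not yet known, as for the
    left action on sums of elementary tensors. *)
Lemma representation_le {H : hilbertType R} (p : A -> H) (w : H) :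
  linear p -> (forall c, hdot (p c) (p c) = hdot (p (amul (astar c) c)) w) ->
  forall a, rnorm (p a) ^+ 2 <= 4 / 3 * rnorm a ^+ 2 * rnorm w ^+ 2.
Proof.
move=> lp pp a; rewrite -rdot_rnorm /rdot pp -/(rdot _ _) -cstar_rnorm.
by apply: state_le => //; rewrite astarM astarK.
Qed.

End cstar.

(** * Amplifications of positive forms *)

Section moments.
Context {R : realType}.

Lemma Bernoulli (x : R) n : 1 <= x -> 1 + n%:R * (x - 1) <= x ^+ n.
Proof.
move=> x1; elim: n => [|n IH]; first by rewrite mul0r addr0 expr0.
rewrite exprS -natr1; have : 0 <= n%:R * (x - 1) * (x - 1).
  by rewrite !mulr_ge0 ?subr_ge0.
nra.
Qed.

(* Along [k = 2 ^ n] the hypotheses give [(m 1 / m 0) ^ k <= C r ^ k / m 0]. *)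
Lemma moment_le (m : nat -> R) (C r : R) : 0 <= r -> 0 <= m 0%N ->
  (forall k, m k ^+ 2 <= m 0%N * m k.*2) -> (forall k, m k <= C * r ^+ k) ->
  m 1%N <= r * m 0%N.
Proof.
move=> r0 m0 mlog mC; have [m00|m0N] := eqVneq (m 0%N) 0.
  have := mlog 1%N; rewrite m00 mul0r real_exprn_even_le0 ?num_real //=.
  by move/eqP->; rewrite mulr0.
have m0_gt0 : 0 < m 0%N by rewrite lt_def m0N.
rewrite leNgt; apply/negP; rewrite -ltr_pdivlMr // => rq.
set q := m 1%N / m 0%N in rq; have q0 : 0 < q by exact: le_lt_trans rq.
have mq n : m 0%N * q ^+ (2 ^ n) <= m (2 ^ n)%N.
  elim: n => [|n IH]; first by rewrite expn0 expr1 mulrC divfK.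
  rewrite -(ler_pM2l m0_gt0); apply: le_trans (le_trans _ (mlog _)) _; last first.
    by rewrite expnS mul2n.
  rewrite mulrA -expr2 expnS mul2n -addnn exprD -expr2 -exprMn.
  have m0q : 0 <= m 0%N * q ^+ (2 ^ n) by rewrite mulr_ge0 // exprn_ge0 // ltW.
  by rewrite ler_sqr ?nnegrE // (le_trans m0q IH).
have [r_eq0|rN0] := eqVneq r 0.
  have := le_trans (mq 0%N) (mC _); rewrite r_eq0 !expr1 mulr0.
  by rewrite leNgt mulr_gt0.
have r_gt0 : 0 < r by rewrite lt_def rN0.
have qr : 1 < q / r by rewrite ltr_pdivlMr // mul1r.
(* Since [n < 2 ^ n], Bernoulli gives (q/r)^(2^n) >= (n + 1)(q/r - 1) > C/m_0, against the upper
   bound. *)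
pose n := Num.truncn (C / m 0%N / (q / r - 1)).
have := truncnS_gt (C / m 0%N / (q / r - 1)); rewrite -/n.
rewrite ltr_pdivrMr ?subr_gt0 //; apply/negP; rewrite -leNgt.
apply: (@le_trans _ _ ((q / r) ^+ (2 ^ n))).
  apply: le_trans (Bernoulli _ (ltW qr)); apply: ler_wpDl => //.
  by apply: ler_wpM2r; [rewrite subr_ge0 ltW|rewrite ler_nat ltn_expl].
rewrite expr_div_n ler_pdivlMr // mulrC mulrA ler_pdivrMr ?exprn_gt0 //.
exact: le_trans (mq n) (mC _).
Qed.

End moments.

(** * Positive forms and sums of elementary tensors *)

Section forms.
Context {R : realType}.

(** Degenerate forms are allowed, since the form [b (X u) v] of a positive operator may be one; a
    bare [lmodType] also admits spaces of pairs. *)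
Record ipform (V : lmodType R[i]) := IPForm {
  ip :> V -> V -> R;
  ipDl : forall u v w, ip (u + v) w = ip u w + ip v w;
  ipZl : forall (t : R) u v, ip (t%:C%C *: u) v = t * ip u v;
  ipC : forall u v, ip u v = ip v u;
  ip_ge0 : forall u, 0 <= ip u u
}.

Section form.
Context {V : lmodType R[i]} (b : ipform V).

Lemma ipDr u v w : b u (v + w) = b u v + b u w.
Proof. by rewrite ipC ipDl !(ipC _ u). Qed.

Lemma ipZr t u v : b u (t%:C%C *: v) = t * b u v.
Proof. by rewrite ipC ipZl (ipC _ u). Qed.

Lemma ipNl u v : b (- u) v = - b u v.
Proof. by rewrite -scaleN1r -(rmorphN1 (real_complex R)) ipZl mulN1r. Qed.

Lemma ipNr u v : b u (- v) = - b u v.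
Proof. by rewrite ipC ipNl ipC. Qed.

Lemma ip_CauchySchwarz u v : b u v ^+ 2 <= b u u * b v v.
Proof.
have [v0|vN0] := eqVneq (b v v) 0.
  have [->|uvN0] := eqVneq (b u v) 0; first by rewrite v0 mulr0 expr0n.
  have uv0 : 0 < b u v ^+ 2 by rewrite exprn_even_gt0.
  (* For a null vector [v] with [b u v] nonzero, this [t] would make the form take the value -1
     below. *)
  pose t := (b u u + 1) / (2 * b u v ^+ 2).
  have := ip_ge0 b (u - (t * b u v)%:C%C *: v).
  rewrite !(ipDl, ipDr, ipNl, ipNr, ipZl, ipZr) (ipC _ v u) v0.
  have : t * (2 * b u v ^+ 2) = b u u + 1 by rewrite divfK // lt0r_neq0 // mulr_gt0.
  nra.
have v_gt0 : 0 < b v v by rewrite lt_def vN0 ip_ge0.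
have := ip_ge0 b ((b v v)%:C%C *: u - (b u v)%:C%C *: v).
rewrite !(ipDl, ipDr, ipNl, ipNr, ipZl, ipZr) (ipC _ v u) => h.
rewrite -subr_ge0 -(pmulr_rge0 _ v_gt0); nra.
Qed.

End form.

Section operator.
Context {V : lmodType R[i]} (b : ipform V) (X : V -> V).
Hypothesis lX : linear X.
Hypothesis X_sym : forall u v, b (X u) v = b u (X v).
Hypothesis X_ge0 : forall u, 0 <= b (X u) u.

Lemma ip_op_subproof : [/\
  forall u v w, b (X (u + v)) w = b (X u) w + b (X v) w,
  forall (t : R) u v, b (X (t%:C%C *: u)) v = t * b (X u) v &
  forall u v, b (X u) v = b (X v) u].
Proof.
split=> [u v w|t u v|u v]; first by rewrite linearD_of // ipDl.
  by rewrite linearZ_of // ipZl.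
by rewrite X_sym ipC.
Qed.

(** Cauchy-Schwarz for the form <Xu, v> at v = Xu gives <Xu, Xu>^2 <= <Xu, u> <XXu, Xu>, and the
    hypothesis bounds both factors. *)
Lemma ip_op_norm (c : R) : (forall u, b (X u) u <= c * b u u) ->
  forall u, b (X u) (X u) <= c ^+ 2 * b u u.
Proof.
move=> Xc u; have [D Z C] := ip_op_subproof.
have := ip_CauchySchwarz (IPForm D Z C X_ge0) u (X u) => /= h.
have [Xu0|XuN0] := eqVneq (b (X u) (X u)) 0.
  by rewrite Xu0 mulr_ge0 ?sqr_ge0 ?ip_ge0.
have Xu_gt0 : 0 < b (X u) (X u) by rewrite lt_def XuN0 ip_ge0.
rewrite -(ler_pM2r Xu_gt0) -expr2; apply: le_trans h _.
have := X_ge0 u; have := Xc u; have := X_ge0 (X u); have := Xc (X u).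
move=> h1 h2 h3 h4; apply: le_trans (ler_pM h4 h2 h3 h1) _.
by rewrite expr2 mulrACA mulrA.
Qed.

End operator.

Section tensor.
Context {V W : lmodType R[i]} (b : ipform V) (w : ipform W) (I : Type).
Context (m : I -> V -> W).
Hypothesis lm : forall i, linear (m i).
Hypothesis m_bounded :
  forall i, exists2 C, 0 <= C & forall v, w (m i v) (m i v) <= C * b v v.

(** With [m i v] read as i ⊗ v, [tmap X] is I ⊗ X on formal sums; it acts on lists because it is not
    yet known to depend only on the value of [tsum]. *)
Definition tsum (s : seq (I * V)) : W := \sum_(p <- s) m p.1 p.2.
Definition tmap (X : V -> V) (s : seq (I * V)) := [seq (p.1, X p.2) | p <- s].

Lemma tsum_cons p s : tsum (p :: s) = m p.1 p.2 + tsum s.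
Proof. exact: big_cons. Qed.

Lemma tsum_nil : tsum [::] = 0. Proof. exact: big_nil. Qed.

Lemma ip0l u : w 0 u = 0.
Proof. by rewrite -(subrr 0) ipDl ipNl subrr. Qed.

Lemma ip0r u : w u 0 = 0. Proof. by rewrite ipC ip0l. Qed.

Definition intertwined (X : V -> V) := forall i j u v,
  w (m i (X u)) (m j v) = w (m i u) (m j (X v)).

Lemma tsum_intertwined X s t : intertwined X ->
  w (tsum (tmap X s)) (tsum t) = w (tsum s) (tsum (tmap X t)).
Proof.
move=> mX; elim: s => [|p s IH]; first by rewrite tsum_nil !ip0l.
rewrite /= !tsum_cons !ipDl /= IH; congr (_ + _).
elim: t {IH} => [|q t IH]; first by rewrite !tsum_nil !ip0r.
by rewrite /= !tsum_cons !ipDr /= IH mX.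
Qed.

Lemma tsum_iter_le X (c : R) s z : 0 <= c ->
  (forall u, b (X u) (X u) <= c ^+ 2 * b u u) ->
  exists C, forall k, w (tsum (tmap (iter k X) s)) z <= C * c ^+ k.
Proof.
move=> c0 Xc; elim: s => [|[i v] s [C CP]].
  by exists 0 => k; rewrite tsum_nil ip0l mul0r.
have [Ci Ci0 CiP] := m_bounded i.
pose K := Ci * b v v; have K0 : 0 <= K by rewrite mulr_ge0 ?ip_ge0.
have z0 := ip_ge0 w z.
(* By Cauchy-Schwarz the head term is at most c^k times the geometric mean of [K] and [w z z], which
   their sum dominates. *)
exists (K + w z z + C) => k; rewrite /= tsum_cons ipDl mulrDl lerD //=.
have ck : 0 <= c ^+ k by rewrite exprn_ge0.
have iter_le : b (iter k X v) (iter k X v) <= c ^+ k ^+ 2 * b v v.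
  elim: k {ck} => [|k IH]; first by rewrite expr1n mul1r.
  rewrite iterS; apply: le_trans (Xc _) _.
  have -> : c ^+ k.+1 ^+ 2 * b v v = c ^+ 2 * (c ^+ k ^+ 2 * b v v).
    by rewrite mulrA -exprMn -exprS.
  by rewrite ler_wpM2l // sqr_ge0.
have [neg|/ltW pos] := leP (w (m i (iter k X v)) z) 0.
  by apply: le_trans neg _; rewrite mulr_ge0 ?addr_ge0.
rewrite -ler_sqr ?nnegrE //; last by rewrite mulr_ge0 ?addr_ge0.
apply: le_trans (ip_CauchySchwarz _ _ _) _.
apply: (@le_trans _ _ (c ^+ k ^+ 2 * K * w z z)).
  rewrite ler_wpM2r //; apply: le_trans (CiP _) _.
  by rewrite /K mulrCA ler_wpM2l.
rewrite exprMn [leRHS]mulrC -mulrA ler_wpM2l ?sqr_ge0 //; nra.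
Qed.

Lemma tsum_le X (c : R) s : 0 <= c -> linear X -> intertwined X ->
  (forall u v, b (X u) v = b u (X v)) ->
  (forall u, 0 <= b (X u) u <= c * b u u) ->
  w (tsum (tmap X s)) (tsum s) <= c * w (tsum s) (tsum s).
Proof.
move=> c0 lX mX X_sym Xc.
have X_norm : forall u, b (X u) (X u) <= c ^+ 2 * b u u.
  by apply: ip_op_norm => // u; have /andP[] := Xc u.
have [C CP] := tsum_iter_le s (tsum s) c0 X_norm.
have tmap0 : tmap (iter 0 X) s = s.
  by rewrite /tmap -[RHS]map_id; apply: eq_map => -[].
have mXk k : intertwined (iter k X).
  by elim: k => [|k IH] i j u v //; rewrite iterS mX IH -iterSr.
pose mu k := w (tsum (tmap (iter k X) s)) (tsum s).
have := @moment_le _ mu C c c0; rewrite /mu tmap0; apply=> //.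
  exact: ip_ge0.
(* Symmetry turns the moment of order 2k into the squared norm of (I ⊗ X^k)s; Cauchy-Schwarz against
   s then gives the hypothesis of [moment_le]. *)
move=> k; rewrite -addnn mulrC.
have -> : tmap (iter (k + k) X) s = tmap (iter k X) (tmap (iter k X) s).
  by rewrite /tmap -map_comp; apply: eq_map => p /=; rewrite iterD.
rewrite [X in _ <= X * _]tsum_intertwined //.
exact: ip_CauchySchwarz.
Qed.

(* If [0 <= B <= c] then [X = c - B] satisfies [0 <= X <= c]. *)
Lemma tsum_ge0 B (c : R) s : 0 <= c -> linear B -> intertwined B ->
  (forall u v, b (B u) v = b u (B v)) ->
  (forall u, 0 <= b (B u) u <= c * b u u) ->
  0 <= w (tsum (tmap B s)) (tsum s).
Proof.
move=> c0 lB mB B_sym Bc; pose X u := c%:C%C *: u - B u.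
have lX : linear X.
  move=> a u v; rewrite /X lB scalerDr scalerBr scalerA mulrC -scalerA.
  by rewrite opprD addrACA.
have mXE i u : m i (X u) = c%:C%C *: m i u - m i (B u).
  by rewrite linearB_of // linearZ_of.
have mX : intertwined X.
  by move=> i j u v; rewrite !mXE !(ipDl, ipDr, ipNl, ipNr, ipZl, ipZr) mB.
have := @tsum_le X c s c0 lX mX.
have -> : tsum (tmap X s) = c%:C%C *: tsum s - tsum (tmap B s).
  elim: s => [|[i v] s IH]; first by rewrite !tsum_nil scaler0 subrr.
  by rewrite /= !tsum_cons /= IH mXE scalerDr opprD addrACA.
rewrite ipDl ipNl ipZl => Xle.
suff : c * w (tsum s) (tsum s) - w (tsum (tmap B s)) (tsum s)
    <= c * w (tsum s) (tsum s) by lra.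
apply: Xle => [u v|u]; rewrite /X !(ipDl, ipDr, ipNl, ipNr, ipZl, ipZr).
  by rewrite B_sym.
by have := Bc u; lra.
Qed.

(* [q] is the form of the operator [B] tensored with the identity. *)
Lemma tensor_ge0 (W' : lmodType R[i]) (m' : I -> V -> W') (q : W' -> W' -> R)
    B (c : R) s :
  (forall u v z, q (u + v) z = q u z + q v z) -> (forall u v, q u v = q v u) ->
  0 <= c -> linear B -> (forall u v, b (B u) v = b u (B v)) ->
  (forall u, 0 <= b (B u) u <= c * b u u) ->
  (forall i j u v, w (m i (B u)) (m j v) = q (m' i u) (m' j v)) ->
  0 <= q (\sum_(p <- s) m' p.1 p.2) (\sum_(p <- s) m' p.1 p.2).
Proof.
move=> qD qC c0 lB B_sym Bc wq.
have q0 v : q 0 v = 0.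
  by have /eqP := qD 0 0 v; rewrite addr0 addrC -subr_eq subrr eq_sym => /eqP.
have qDr u v z : q u (v + z) = q u v + q u z by rewrite qC qD !(qC _ u).
have mB : intertwined B.
  by move=> i j u v; rewrite wq qC -wq ipC.
suff <- : w (tsum (tmap B s)) (tsum s)
    = q (\sum_(p <- s) m' p.1 p.2) (\sum_(p <- s) m' p.1 p.2).
  exact: tsum_ge0 Bc.
elim: {1 3}s => [|[i u] r IH]; first by rewrite tsum_nil ip0l big_nil q0.
rewrite /= tsum_cons big_cons ipDl qD /= IH; congr (_ + _).
elim: s {IH} => [|[j v] s IH]; first by rewrite tsum_nil ip0r big_nil qC q0.
by rewrite tsum_cons big_cons ipDr qDr /= IH wq.
Qed.

End tensor.

Section product.
Context {V W : lmodType R[i]} (b : ipform V) (w : ipform W).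

Let q (u v : (V * W)%type) := b u.1 v.1 + w u.2 v.2.

Let qDl u v z : q (u + v) z = q u z + q v z.
Proof. by rewrite /q !ipDl addrACA. Qed.

Let qZl (t : R) u v : q (t%:C%C *: u) v = t * q u v.
Proof. by rewrite /q !ipZl mulrDr. Qed.

Let qC u v : q u v = q v u. Proof. by rewrite /q ipC [w _ _]ipC. Qed.

Let q_ge0 u : 0 <= q u u. Proof. by rewrite addr_ge0 ?ip_ge0. Qed.

(** The dual inequality concerns pairs (z, u) from two levels; this is the form of their orthogonal
    sum. *)
Definition prod_form : ipform (V * W)%type := IPForm qDl qZl qC q_ge0.

End product.

End forms.

(** * Tensor products *)

Lemma hdot_lincomb {R : realType} {H H' : hilbertType R} (I : Type)
    (f g : I -> H) (f' g' : I -> H') s t :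
  (forall i j, hdot (f i) (g j) = hdot (f' i) (g' j)) ->
  hdot (lincomb f s) (lincomb g t) = hdot (lincomb f' s) (lincomb g' t).
Proof.
move=> fg; rewrite /lincomb.
elim: s => [|p s IH]; first by rewrite !big_nil /= !linear0l.
rewrite !big_cons !hdotDl IH !hdotZl; congr (_ * _ + _).
elim: t {IH} => [|q t IH]; first by rewrite !big_nil /= !hdot0r.
by rewrite !big_cons !hdotDr IH !hdotZr fg.
Qed.

Lemma hdot_injr_total {R : realType} {H : hilbertType R} (S : set H) (w w' : H) :
  closed_span S = setT -> (forall u, S u -> hdot u w = hdot u w') -> w = w'.
Proof.
move=> St ww'; apply: hdot_injr => u; apply/eqP.
rewrite -subr_eq0 -hdotBr; apply/eqP.
have uS : closed_span S u by rewrite St.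
suff : closed_span S `<=` [set u | forall z, [set w - w'] z -> hdot u z = 0].
  by move=> /(_ u uS); apply.
apply: closed_span_min; first exact: closed_subspace_orth.
by move=> z /ww' zw _ ->; rewrite hdotBr zw subrr.
Qed.

Section hilbert_module.
Context {R : realType} {A : cstarAlgType R} {E : hilbertModType A}.

Lemma adot_rnorm (x : E) : rnorm (adot x x) = rnorm x ^+ 2.
Proof. by rewrite /rnorm -adot_norm rnormE -(rmorphXn (real_complex R)). Qed.

End hilbert_module.

Section tensor_action.
Context {R : realType} {A : cstarAlgType R} {E : cstarCorrType A}.
Context {H : hilbertType R} (S : covariant_rep E H).

(** [sigma_bounded] bounds each operator separately; a bound linear in |a| makes [htens] jointly
    bounded. *)
Lemma sigma_rnorm a h : rnorm (sigma S a h) <= 2 * rnorm a * rnorm h.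
Proof.
have [h0 a0] := (rnorm_ge0 h, rnorm_ge0 a).
have : rnorm (sigma S a h) ^+ 2 <= 4 / 3 * rnorm a ^+ 2 * rnorm h ^+ 2.
  apply: (@representation_le _ _ _ (sigma S ^~ h)).
    by move=> c b d; rewrite sigma_linear.
  by move=> c; rewrite sigmaM !sigma_star astarK.
have : 0 <= (rnorm a * rnorm h) ^+ 2 by exact: sqr_ge0.
rewrite -[rnorm _ <= _]ler_sqr ?nnegrE ?rnorm_ge0 ?mulr_ge0 // !exprMn; nra.
Qed.

Section module.
Context {F : hilbertModType A} (T : hilbert_tensor F (sigma S)).
Implicit Types (x y : F) (h k : H).

Lemma htens_rnorm x h : rnorm (htens T x h) <= 2 * rnorm x * rnorm h.
Proof.
have [h0 x0] := (rnorm_ge0 h, rnorm_ge0 x).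
have : rnorm (htens T x h) ^+ 2 <= 2 * rnorm x ^+ 2 * rnorm h ^+ 2.
  rewrite -rdot_rnorm /rdot htens_hdot -/(rdot _ _).
  apply: le_trans (rdot_CauchySchwarz _ _) _.
  have := sigma_rnorm (adot x x) h; rewrite adot_rnorm; nra.
have : 0 <= (rnorm x * rnorm h) ^+ 2 by exact: sqr_ge0.
rewrite -[rnorm _ <= _]ler_sqr ?nnegrE ?rnorm_ge0 ?mulr_ge0 // !exprMn; nra.
Qed.

Lemma htens_boundedl h : bounded_operator (htens T ^~ h).
Proof.
apply/bounded_rnorm; split=> [c x y|]; first exact: htens_linearl.
have := rnorm_ge0 h => h0; exists (2 * rnorm h + 1) => [|x]; first by lra.
by have := htens_rnorm x h; have := rnorm_ge0 x; nra.
Qed.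

Lemma htens_boundedr x : bounded_operator (htens T x).
Proof.
apply/bounded_rnorm; split=> [c h k|]; first exact: htens_linearr.
have := rnorm_ge0 x => x0; exists (2 * rnorm x + 1) => [|h]; first by lra.
by have := htens_rnorm x h; have := rnorm_ge0 h; nra.
Qed.

Lemma htens_sub_range :
  [set z | exists x h, z = htens T x h] `<=` range (fun p => htens T p.1 p.2).
Proof. by move=> _ [x [h ->]]; exists (x, h). Qed.

End module.

Section correspondence.
Context {F : cstarCorrType A} (T : hilbert_tensor F (sigma S)).
Implicit Types (x y : F) (h k : H) (a : A).

Lemma htens_lact a x h y k :
  hdot (htens T (lact a x) h) (htens T y k)
    = hdot (htens T x h) (htens T (lact (astar a) y) k).
Proof. by rewrite !htens_hdot lact_adot. Qed.

(** For a fixed sum z, the map taking a to a·z meets [representation_le] with [w = z], because the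
    left action respects adjoints. The [+ 1] keeps the constant positive, as [extend_total]
    requires. *)
Lemma htens_lact_rnorm a (s : seq (R[i] * (F * H))) :
  rnorm (lincomb (fun p => htens T (lact a p.1) p.2) s)
    <= 2 * (rnorm a + 1) * rnorm (lincomb (fun p => htens T p.1 p.2) s).
Proof.
set z := lincomb (fun p => htens T p.1 p.2) s.
have [z0 a0] := (rnorm_ge0 z, rnorm_ge0 a).
pose p a := lincomb (fun p => htens T (lact a p.1) p.2) s.
have : rnorm (p a) ^+ 2 <= 4 / 3 * rnorm a ^+ 2 * rnorm z ^+ 2.
  apply: representation_le => [c b d|c]; last first.
    by apply: hdot_lincomb => i j; rewrite lactM !htens_lact astarK.
  rewrite /p /lincomb scaler_sumr -big_split /=; apply: eq_bigr => q _.
  by rewrite lact_linearl htens_linearl scalerDr !scalerA mulrC.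
have : 0 <= (rnorm a * rnorm z) ^+ 2 by exact: sqr_ge0.
have : 0 <= rnorm a * rnorm z ^+ 2 by rewrite mulr_ge0 ?sqr_ge0.
have := sqr_ge0 (rnorm z).
rewrite -[rnorm _ <= _]ler_sqr ?nnegrE ?rnorm_ge0 ?mulr_ge0 ?addr_ge0 //.
rewrite /p !exprMn; nra.
Qed.

Lemma tlact_exists a : exists2 r : T -> T, bounded_operator r &
  forall x h, r (htens T x h) = htens T (lact a x) h.
Proof.
have [|r br rE] := extend_total (htens_total T) (@htens_sub_range _ T)
  _ (htens_lact_rnorm a); first by have := rnorm_ge0 a; lra.
by exists r => // x h; exact: (rE (x, h)).
Qed.

Definition tlact a : T -> T := sval (cid2 (tlact_exists a)).

Lemma tlact_bounded a : bounded_operator (tlact a).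
Proof. by rewrite /tlact; case: cid2. Qed.

Lemma tlactE a x h : tlact a (htens T x h) = htens T (lact a x) h.
Proof. by rewrite /tlact; case: cid2. Qed.

Context (FF : interior_tensor E F) (TT : hilbert_tensor FF (sigma S)).

(** The operator taking u to x ⊗ u, which realizes the associativity E ⊗ (F ⊗ H) = (E ⊗ F) ⊗ H. It
    is bounded because |x ⊗ u|^2 = <u, <x, x> u>. *)
Lemma creation_exists (x : E) : exists2 f : T -> TT, bounded_operator f &
  forall y h, f (htens T y h) = htens TT (tens FF x y) h.
Proof.
have [_ [M M0 rM]] := iffLR (bounded_rnorm _) (tlact_bounded (adot x x)).
have [||f bf fE] := @extend_total _ _ _ _ (fun p => htens T p.1 p.2)
  (fun p => htens TT (tens FF x p.1) p.2) _ (M + 1)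
  (htens_total T) (@htens_sub_range _ T); [by lra| |]; last first.
  by exists f => // y h; exact: (fE (y, h)).
move=> s; set z := lincomb _ s; set u := lincomb _ s.
have zu : rdot z z = rdot u (tlact (adot x x) u).
  rewrite /rdot {2}/u /lincomb (linear_sum_of (tlact_bounded _).1).
  congr complex.Re; transitivity (hdot u
      (lincomb (fun p => htens T (lact (adot x x) p.1) p.2) s)).
    by apply: hdot_lincomb => i j; rewrite !htens_hdot tens_adot.
  congr (hdot u _); apply: eq_bigr => p _.
  by rewrite linearZ_of ?tlactE //; exact: (tlact_bounded _).1.
have := rdot_CauchySchwarz u (tlact (adot x x) u); rewrite -zu rdot_rnorm.
have := rM u; have [z0 u0] := (rnorm_ge0 z, rnorm_ge0 u).
move=> h1 h2; have h3 : rnorm z ^+ 2 <= M * rnorm u ^+ 2 by nra.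
rewrite -ler_sqr ?nnegrE ?mulr_ge0 //; last by lra.
have := sqr_ge0 (rnorm u); rewrite exprMn; nra.
Qed.

Definition creation (x : E) : T -> TT := sval (cid2 (creation_exists x)).

Lemma creation_bounded (x : E) : bounded_operator (creation x).
Proof. by rewrite /creation; case: cid2. Qed.

Lemma creationE (x : E) y h : creation x (htens T y h) = htens TT (tens FF x y) h.
Proof. by rewrite /creation; case: cid2. Qed.

(** This is the inner product formula of E ⊗ (F ⊗ H), so [TT] serves as that tensor product;
    totality in each variable reduces it to elementary tensors. *)
Lemma creation_dot (x y : E) u v :
  hdot (creation x u) (creation y v) = hdot u (tlact (adot x y) v).
Proof.
rewrite (adjointP (creation_bounded x)); congr (hdot u _).
suff /(congr1 (@^~ v)) : adjoint (creation x) \o creation y = tlact (adot x y) by [].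
apply: (eq_on_total (htens_total T)); last 1 first.
- move=> _ [z [k ->]]; apply: hdot_injr_total (htens_total T) _.
  move=> _ [z' [h ->]] /=; rewrite -(adjointP (creation_bounded x)).
  by rewrite !creationE tlactE !htens_hdot tens_adot.
- apply: bounded_operator_comp; first exact: creation_bounded.
  exact/adjoint_bounded/creation_bounded.
- exact: tlact_bounded.
Qed.

End correspondence.

Arguments tlact {F} T a _.
Arguments creation {F} T {FF} TT x _.

Section creation.
Context {F : cstarCorrType A} (T : hilbert_tensor F (sigma S)).
Context (FF : interior_tensor E F) (TT : hilbert_tensor FF (sigma S)).

Lemma tlact_creation a (x : E) (u : T) :
  tlact TT a (creation T TT x u) = creation T TT (lact a x) u.
Proof.
suff /(congr1 (@^~ u)) :
  tlact TT a \o creation T TT x = creation T TT (lact a x) by [].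
apply: (eq_on_total (htens_total T)); last 1 first.
- by move=> _ [z [k ->]] /=; rewrite !creationE tlactE tens_lact.
- apply: bounded_operator_comp; first exact: creation_bounded.
  exact: tlact_bounded.
- exact: creation_bounded.
Qed.

(** One inclusion approximates the vector of F ⊗ K with [x] fixed, the other the vector of E ⊗ F
    with [k] fixed. *)
Lemma creation_span (K : set H) :
  let span (G : hilbertModType A) (TG : hilbert_tensor G (sigma S)) :=
    closed_span [set z | exists x k, K k /\ z = htens TG x k] in
  closed_span [set z | exists x u, span _ T u /\ z = creation T TT x u]
    = span _ TT.
Proof.
move=> span; apply/seteqP; split; apply: closed_spanS.
  move=> _ [x [u [Tu ->]]].
  apply: (closed_span_image (creation_bounded T TT x)) Tu => _ [y [k [Kk ->]]].
  by apply: sub_closed_span; exists (tens FF x y), k; split=> //; rewrite creationE.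
move=> _ [z [k [Kk ->]]].
have zF : closed_span [set z | exists x y, z = tens FF x y] z by rewrite tens_total.
apply: (closed_span_image (htens_boundedl TT k)) zF => _ [x [y ->]].
apply: sub_closed_span; exists x, (htens T y k); rewrite creationE; split=> //.
by apply: sub_closed_span; exists y, k.
Qed.

End creation.

End tensor_action.

Arguments tlact {R A E H S F} T a _.
Arguments creation {R A E H S F} T {FF} TT x _.

(** * The Fock tower *)

Section tower.
Context {R : realType} {A : cstarAlgType R} {E : cstarCorrType A}.
Context {H : hilbertType R} (S : covariant_rep E H).
Context (ten : forall F : cstarCorrType A, interior_tensor E F).
Context (tenH : forall F : hilbertModType A, hilbert_tensor F (sigma S)).
Hypothesis S_cb : completely_bounded tenH.

Lemma TtildeP : is_Ttilde (Ttilde tenH).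
Proof. by rewrite /Ttilde; case: xgetP => [_ -> //|]; case: S_cb => f fP /(_ f). Qed.

(** The covariance axiom has [sigma b] on the right, and [sigma] may be degenerate. On the closed
    span of its ranges the axiom applies through balancing; for q orthogonal to it every T(y)q
    vanishes, because |y ⊗ q|^2 = <q, sigma(<y, y>) q> = 0. *)
Lemma repT_lact a x h : repT S (lact a x) h = sigma S a (repT S x h).
Proof.
have [bT TE] := TtildeP.
pose N := closed_span [set z | exists b k, z = sigma S b k].
have [p Np hp] := projection h (closed_span_closed [set z | exists b k, z = sigma S b k]).
have cov := closed_subspace_eqlocus (repT_bounded S (lact a x))
  (bounded_operator_comp (repT_bounded S x) (sigma_bounded S a)).
have Tq y : repT S y (h - p) = 0.
  have [lT _] := bT; rewrite -TE (_ : htens _ _ _ = 0) ?linear0_of //.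
  apply: hdot_eq0; rewrite htens_hdot; apply: hp.
  by apply: sub_closed_span; exists (adot y y), (h - p).
have {p Np hp Tq} [p [Np Tp]] : exists p, N p /\ forall y, repT S y h = repT S y p.
  exists p; split=> // y; have := Tq y.
  rewrite (linearB_of (repT_bounded S y).1) => /eqP.
  by rewrite subr_eq0 => /eqP.
rewrite !Tp; apply: (closed_span_min cov) Np => _ [b [k ->]] /=.
by rewrite -repT_covariant -!TE htens_balanced.
Qed.

(* [level n] is $E^{\otimes n} \otimes H$. *)
Definition level (n : nat) : hilbertType R :=
  if n is m.+1 then tenH (tpow ten m) else H.

Definition level_act (n : nat) (a : A) : level n -> level n :=
  match n with 0 => sigma S a | m.+1 => tlact (tenH (tpow ten m)) a end.

(** The operator taking u to x ⊗ u. Level 0 is a separate case since E^0 ⊗ H is [H] itself. *)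
Definition shift (n : nat) (x : E) : level n -> level n.+1 :=
  match n with
  | 0 => htens (tenH E) x
  | m.+1 => creation (tenH (tpow ten m)) (tenH (tpow ten m.+1)) x
  end.

(* [level_span K n] is $E^{\otimes n} \otimes K$. *)
Definition level_span (K : set H) (n : nat) : set (level n) :=
  match n with 0 => K | m.+1 => tenK tenH (tpow ten m) K end.
Arguments level_span K n _ : clear implicits.

Lemma level_act_bounded n a : bounded_operator (@level_act n a).
Proof. by case: n => [|n]; [exact: sigma_bounded|exact: tlact_bounded]. Qed.

Lemma shift_bounded n x : bounded_operator (@shift n x).
Proof. by case: n => [|n]; [exact: htens_boundedr|exact: creation_bounded]. Qed.

Lemma shift_dot n x y (u v : level n) :
  hdot (shift x u) (shift y v) = hdot u (level_act (adot x y) v).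
Proof. by case: n u v => [|n] u v; [exact: htens_hdot|exact: creation_dot]. Qed.

Lemma level_act_shift n a x (u : level n) :
  level_act a (shift x u) = shift (lact a x) u.
Proof. by case: n u => [|n] u; [exact: tlactE|exact: tlact_creation]. Qed.

Lemma level_span_closed K n : closed_subspace K -> closed_subspace (level_span K n).
Proof. by case: n => [//|n] _; exact: closed_span_closed. Qed.

Lemma level_spanS K n :
  closed_span [set z | exists x u, level_span K n u /\ z = shift x u]
    = level_span K n.+1.
Proof. by case: n => [//|n]; exact: creation_span. Qed.

Lemma level_spanT n : level_span setT n = setT.
Proof.
case: n => [//|n] /=; rewrite -(htens_total (tenH (tpow ten n))) /tenK.
congr closed_span; apply/seteqP.
by split=> z [x [k]]; [case=> _ ->|move=> ->]; exists x, k.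
Qed.

Lemma shift_total n :
  closed_span [set z | exists x (u : level n), z = shift x u] = setT.
Proof.
rewrite -(level_spanT n.+1) -level_spanS level_spanT; congr closed_span.
by apply/seteqP; split=> z [x [k]]; [move=> ->|case=> _ ->]; exists x, k.
Qed.

Lemma shift_sub_range n :
  [set z | exists x (u : level n), z = shift x u]
    `<=` range (fun p => shift p.1 p.2).
Proof. by move=> _ [x [u ->]]; exists (x, u). Qed.

Lemma level_span_act K n a u : (forall k, K k -> K (sigma S a k)) ->
  level_span K n u -> level_span K n (level_act a u).
Proof.
case: n u => [|n] u Ka; first exact: Ka.
apply: closed_span_image; first exact: tlact_bounded.
move=> _ [x [k [Kk ->]]]; rewrite /= tlactE; apply: sub_closed_span.
by exists (lact a x), k.
Qed.

Lemma level_span_shift K n x u : level_span K n u -> level_span K n.+1 (shift x u).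
Proof. by move=> Ku; rewrite -level_spanS; apply: sub_closed_span; exists x, u. Qed.

Definition hform (V : hilbertType R) : ipform V :=
  IPForm (@rdotDl R V) (@rdotZl R V) (@rdotC R V) (@rdot_ge0 R V).

(** Absorbing scalars into the second factor gives plain sums, the shape treated by [tensor_ge0]. *)
Lemma lincomb_shift n (s : seq (R[i] * (E * level n))) :
  lincomb (fun p => shift p.1 p.2) s
    = \sum_(p <- [seq (p.2.1, p.1 *: p.2.2) | p <- s]) shift p.1 p.2.
Proof.
rewrite big_map; apply: eq_bigr => p _ /=.
by rewrite linearZ_of //; exact: (@shift_bounded _ _).1.
Qed.

Lemma adjointPr {V W : hilbertType R} (f : V -> W) : bounded_operator f ->
  forall u v, hdot (adjoint f v) u = hdot v (f u).
Proof. by move=> bf u v; rewrite hdotC -adjointP // -hdotC. Qed.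

(** Both sides pair through the action of <x, y>, which [d] commutes with; so I ⊗ [adjoint d] is
    adjoint to I ⊗ [d] on elementary tensors. *)
Lemma shift_adjoint_dot n m (d : level n -> level m) x y v u :
  bounded_operator d -> (forall a z, d (level_act a z) = level_act a (d z)) ->
  hdot (shift x (adjoint d v)) (shift y u) = hdot (shift x v) (shift y (d u)).
Proof. by move=> bd da; rewrite !shift_dot adjointPr // da. Qed.

Lemma shift_norm_le n x :
  exists2 C, 0 <= C & forall v : level n, rdot (shift x v) (shift x v) <= C * rdot v v.
Proof.
have [_ [M M0 xM]] := iffLR (bounded_rnorm _) (@shift_bounded n x).
exists (M ^+ 2) => [|v]; first exact: sqr_ge0.
by rewrite !rdot_rnorm -exprMn ler_sqr ?nnegrE ?rnorm_ge0 ?mulr_ge0 ?rnorm_ge0 // ltW.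
Qed.

(* The operator $I_E \otimes d$. *)
Lemma ampliation_exists n (d : level n.+1 -> level n) :
  bounded_operator d -> (forall a u, d (level_act a u) = level_act a (d u)) ->
  exists2 f : level n.+2 -> level n.+1, bounded_operator f &
    forall x u, f (shift x u) = shift x (d u).
Proof.
move=> bd da; have bd' := adjoint_bounded bd.
have [ld [M M0 dM]] := iffLR (bounded_rnorm _) bd; have [ld' _] := bd'.
(* [B] is positive by the choice of [M]. On pairs (x ⊗ u, x ⊗ du) its ampliation is the form [q],
   whose positivity on sums bounds I ⊗ [d] by [M]. *)
pose B u := (M ^+ 2)%:C%C *: u - adjoint d (d u).
pose q (u v : (level n.+2 * level n.+1)%type) :=
  M ^+ 2 * rdot u.1 v.1 - rdot u.2 v.2.
have main s : rnorm (\sum_(p <- s) shift p.1 (d p.2))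
    <= M * rnorm (\sum_(p <- s) shift p.1 p.2 : level n.+2).
  rewrite -ler_sqr ?nnegrE ?mulr_ge0 ?rnorm_ge0 ?(ltW M0) // exprMn -!rdot_rnorm.
  rewrite -subr_ge0.
  have := @tensor_ge0 _ _ _ (hform (level n.+1)) (hform (level n.+2)) E
    (@shift n.+1) (fun x => (@shift_bounded _ x).1) (@shift_norm_le n.+1)
    _ (fun x u => (shift x u, shift x (d u))) q B (M ^+ 2) s.
  have -> : \sum_(p <- s) (shift p.1 p.2, shift p.1 (d p.2))
      = (\sum_(p <- s) shift p.1 p.2, \sum_(p <- s) shift p.1 (d p.2)).
    elim: s => [|p s IH]; first by rewrite !big_nil.
    by rewrite !big_cons IH.
  apply.
  - by move=> u v z; rewrite /q !rdotDl; ring.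
  - by move=> u v; rewrite /q rdotC [rdot u.2 _]rdotC.
  - exact: sqr_ge0.
  - move=> c u v; rewrite /B ld ld' scalerDr scalerBr scalerA mulrC -scalerA.
    by rewrite opprD addrACA.
  - move=> u v /=; rewrite /B rdotBl rdotZl rdotBr [rdot u (_ *: _)]rdotC rdotZl.
    rewrite [rdot v u]rdotC -(adjoint_rdot bd) [rdot (adjoint d _) _]rdotC.
    by rewrite -(adjoint_rdot bd) [rdot (d v) _]rdotC.
  - move=> u /=; rewrite /B rdotBl rdotZl [rdot (adjoint d _) _]rdotC.
    rewrite -(adjoint_rdot bd) !rdot_rnorm subr_ge0 lerBlDr lerDl sqr_ge0 andbT.
    by rewrite -exprMn ler_sqr ?nnegrE ?rnorm_ge0 ?mulr_ge0 ?rnorm_ge0 // ltW.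
  - move=> x y u v; rewrite -[LHS]/(rdot (shift x (B u)) (shift y v)) /B /q.
    have lS := (@shift_bounded n.+1 x).1.
    rewrite (linearB_of lS) (linearZ_of lS) rdotBl rdotZl.
    by congr (_ - _); rewrite /rdot shift_adjoint_dot.
have [|f bf fE] := @extend_total _ _ _ _ (fun p => shift p.1 p.2 : level n.+2)
  (fun p => shift p.1 (d p.2)) _ M (shift_total _) (@shift_sub_range _) M0.
  move=> s; rewrite lincomb_shift; have := main [seq (p.2.1, p.1 *: p.2.2) | p <- s].
  rewrite !big_map /=; congr (_ <= _); congr rnorm; apply: eq_bigr => p _.
  by rewrite !linearZ_of //; exact: (@shift_bounded _ _).1.
by exists f => // x u; exact: (fE (x, u)).
Qed.

End tower.

Arguments shift : simpl never.
Arguments level_act : simpl never.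

Lemma adjoint_comp {R : realType} {U V W : hilbertType R} (f : U -> V) (g : V -> W) :
  bounded_operator f -> bounded_operator g ->
  adjoint (g \o f) = adjoint f \o adjoint g.
Proof.
move=> bf bg; apply/funext => w; apply: hdot_injr => u /=.
by rewrite -!adjointP //; exact: bounded_operator_comp.
Qed.

(** * The operators between the levels and their products *)

Section down.
Context {R : realType} {A : cstarAlgType R} {E : cstarCorrType A}.
Context {H : hilbertType R} (S : covariant_rep E H).
Context (ten : forall F : cstarCorrType A, interior_tensor E F).
Context (tenH : forall F : hilbertModType A, hilbert_tensor F (sigma S)).
Hypothesis S_cb : completely_bounded tenH.

Local Notation level := (level ten tenH).
Local Notation shift := (shift (ten := ten) (tenH := tenH)).
Local Notation level_act := (level_act (ten := ten) (tenH := tenH)).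

(* [down n] is $I_{E^{\otimes n}} \otimes \widetilde T$. *)
Fixpoint down (n : nat) : level n.+1 -> level n :=
  match n return level n.+1 -> level n with
  | 0 => Ttilde tenH
  | m.+1 => xget (fun=> 0) [set f | bounded_operator f /\
      forall x u, f (shift x u) = shift x (@down m u)]
  end.

(** The choice made by [xget] at one level exists because the previous operator is bounded and
    commutes with the left action, so the three facts share one induction. *)
Lemma down_spec n : [/\ bounded_operator (@down n),
  forall a (u : level n.+1), down (level_act a u) = level_act a (down u) &
  forall x (u : level n.+1), down (shift x u) = shift x (down u)].
Proof.
have step m : bounded_operator (@down m) ->
    (forall a (u : level m.+1), down (level_act a u) = level_act a (down u)) ->
    bounded_operator (@down m.+1) /\
    forall x (u : level m.+1), down (shift x u) = shift x (down u).
  move=> bd da; have [f bf fE] := ampliation_exists bd da.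
  by rewrite /=; case: xgetP => [_ -> //|/(_ f)[]].
elim: n => [|n [bd da ds]].
  have [bT TE] := TtildeP S_cb.
  have da a (u : level 1) : down (level_act a u) = level_act a (down u).
    suff /(congr1 (@^~ u)) : @down 0 \o level_act a = level_act a \o @down 0 by [].
    apply: (eq_on_total (shift_total ten tenH 0)); last 1 first.
    - move=> _ [x [h ->]]; rewrite /comp level_act_shift [LHS]TE [down _]TE.
      by rewrite (repT_lact S_cb).
    - by apply: bounded_operator_comp bT; exact: level_act_bounded.
    - by apply: bounded_operator_comp => //; exact: level_act_bounded.
  by split=> //; have [] := step 0%N bT da.
have [bd' ds'] := step n bd da.
have da' a (u : level n.+2) : down (level_act a u) = level_act a (down u).
  suff /(congr1 (@^~ u)) :
    @down n.+1 \o level_act a = level_act a \o @down n.+1 by [].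
  apply: (eq_on_total (shift_total ten tenH n.+1)); last 1 first.
  - by move=> _ [x [h ->]]; rewrite /comp level_act_shift !ds' level_act_shift.
  - by apply: bounded_operator_comp bd'; exact: level_act_bounded.
  - by apply: bounded_operator_comp => //; exact: level_act_bounded.
by split=> //; have [] := step n.+1 bd' da'.
Qed.

Lemma down_bounded n : bounded_operator (@down n).
Proof. by have [] := down_spec n. Qed.

Lemma down_act n a (u : level n.+1) : down (level_act a u) = level_act a (down u).
Proof. by have [_ + _] := down_spec n; apply. Qed.

Lemma down_shift n x (u : level n.+1) : down (shift x u) = shift x (down u).
Proof. by have [_ _] := down_spec n; apply. Qed.

Lemma down0_shift x (h : level 0) : down (shift x h) = repT S x h.
Proof. exact: (TtildeP S_cb).2. Qed.

(** T~_n as a product of the [down] operators, with the identity for n = 0; [TtildeS_collapse]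
    proves the agreement. *)
Fixpoint collapse (n : nat) : level n -> H :=
  match n return level n -> H with 0 => idfun | m.+1 => @collapse m \o @down m end.

Lemma collapse_bounded n : bounded_operator (@collapse n).
Proof.
elim: n => [|n IH]; first exact: bounded_operator_id.
by apply: bounded_operator_comp IH; exact: down_bounded.
Qed.

(** [collapse] contracts the last factor first; this recursion on the first factor is the one that
    [etens] follows. *)
Lemma collapse_shift n x (u : level n) :
  collapse (shift x u) = repT S x (collapse u).
Proof.
elim: n u => [|n IH] u; first by rewrite [LHS]down0_shift.
rewrite [LHS]/(collapse (down (shift x u))) down_shift; exact: IH.
Qed.

Lemma etens_shift n (xs : n.+2.-tuple E) h :
  htens (tenH (tpow ten n.+1)) (etens ten xs) h
    = shift (thead xs)
        (htens (tenH (tpow ten n)) (etens ten [tuple of behead xs]) h : level n.+1).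
Proof. by rewrite [RHS]creationE. Qed.

Lemma collapse_etens n (xs : n.+1.-tuple E) h :
  @collapse n.+1 (htens (tenH (tpow ten n)) (etens ten xs) h) = foldr (repT S) h xs.
Proof.
elim: n xs => [|n IH] xs.
  rewrite [LHS]down0_shift; case/tupleP: xs => x xs.
  by rewrite [etens _ _]theadE tuple0.
rewrite etens_shift collapse_shift IH.
by case/tupleP: xs => x xs; rewrite theadE.
Qed.

(** [TtildeS] is specified on these vectors only, and their totality makes the specification
    unique. *)
Lemma etens_total n :
  closed_span [set z | exists (xs : n.+1.-tuple E) h,
    z = htens (tenH (tpow ten n)) (etens ten xs) h] = setT.
Proof.
elim: n => [|n IH].
  rewrite -(htens_total (tenH E)); congr closed_span.
  apply/seteqP; split=> z [x [h ->]]; first by exists (thead x), h.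
  by exists [tuple x], h; rewrite /= theadE.
apply/seteqP; split=> // z _.
have : closed_span [set z | exists x (u : level n.+1), z = shift x u] z.
  by rewrite shift_total.
apply: closed_spanS => _ [x [u ->]].
have : closed_span [set z | exists (xs : n.+1.-tuple E) h,
    z = htens (tenH (tpow ten n)) (etens ten xs) h] u by rewrite IH.
apply: (closed_span_image (@shift_bounded _ _ _ _ S ten tenH n.+1 x)) => _ [xs [h ->]].
apply: sub_closed_span; exists [tuple of x :: xs], h.
rewrite etens_shift theadE.
congr (shift _ (htens (tenH (tpow ten n)) (etens ten _) _ : level n.+1)).
exact: val_inj.
Qed.

Lemma TtildeS_collapse n : TtildeS ten tenH n = @collapse n.+1.
Proof.
have : [set f | bounded_operator f /\ forall (xs : n.+1.-tuple E) h,
    f (htens (tenH (tpow ten n)) (etens ten xs) h) = foldr (repT S) h xs]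
    (TtildeS ten tenH n).
  rewrite /TtildeS; case: xgetP => [_ -> //|/(_ (@collapse n.+1))[]].
  by split; [exact: (collapse_bounded n.+1)|exact: collapse_etens].
case=> bT TE; apply: (eq_on_total (etens_total n)) => //.
  exact: (collapse_bounded n.+1).
by move=> _ [xs [h ->]]; rewrite TE collapse_etens.
Qed.

End down.

Arguments down : simpl never.

(** * The dual inequality *)

(** Carries the dual inequality from finite sums to all vectors; [a'], [b'] and [c'] are norms of
    approximants. *)
Lemma sqr_le_limit {R : realType} (a b c : R) : 0 <= a -> 0 <= b -> 0 <= c ->
  (forall t, 0 < t -> t <= 1 -> exists a' b' c',
    [/\ 0 <= b', 0 <= c' & a <= a' + t] /\
    [/\ b' <= b + t, c' <= c + t & a' ^+ 2 <= 2 * (b' ^+ 2 + c' ^+ 2)]) ->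
  a ^+ 2 <= 2 * (b ^+ 2 + c ^+ 2).
Proof.
move=> a0 b0 c0 abc; apply/ler_addgt0Pr => e e0.
(* Expanding (a - t)^2 <= 2((b + t)^2 + (c + t)^2) with t <= 1 leaves an error of at most tK. *)
pose K := 2 * a + 4 * b + 4 * c + 3; have K0 : 0 < K by rewrite /K; lra.
pose t := Num.min 1 (e / K); have t1 : t <= 1 by rewrite ge_min lexx.
have t0 : 0 < t by rewrite lt_min ltr01 divr_gt0.
have tK : t * K <= e by rewrite -ler_pdivlMr // ge_min lexx orbT.
have [a' [b' [c' [[b'0 c'0 aa'] [b'b c'c ineq]]]]] := abc t t0 t1.
have b2 : b' ^+ 2 <= (b + t) ^+ 2 by rewrite ler_sqr ?nnegrE // addr_ge0 // ltW.
have c2 : c' ^+ 2 <= (c + t) ^+ 2 by rewrite ler_sqr ?nnegrE // addr_ge0 // ltW.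
have bc : 0 <= b ^+ 2 + c ^+ 2 by rewrite addr_ge0 ?sqr_ge0.
have tb : 0 <= t * b by rewrite mulr_ge0 // ltW.
have tc : 0 <= t * c by rewrite mulr_ge0 // ltW.
have ta : 0 <= t * a by rewrite mulr_ge0 // ltW.
have tt : t ^+ 2 <= t by rewrite expr2 ler_piMl // ltW.
rewrite /K in tK; have [at_|ta_] := leP a t.
  have : a ^+ 2 <= t * a by rewrite expr2 ler_wpM2r.
  nra.
have : (a - t) ^+ 2 <= a' ^+ 2 by rewrite ler_sqr ?nnegrE; lra.
nra.
Qed.

Section Shimorin.
Context {R : realType} {A : cstarAlgType R} {E : cstarCorrType A}.
Context {H : hilbertType R} (S : covariant_rep E H).
Context (ten : forall F : cstarCorrType A, interior_tensor E F).
Context (tenH : forall F : hilbertModType A, hilbert_tensor F (sigma S)).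
Hypothesis S_cb : completely_bounded tenH.

Local Notation level := (level ten tenH).
Local Notation shift := (shift (ten := ten) (tenH := tenH)).
Local Notation "'down_ n" := (@down R A E H S ten tenH n)
  (at level 0, n at level 2).

Hypothesis down0_inj : forall u : level 1, down u = 0 -> u = 0.
Hypothesis down0_ineq : forall u : level 1,
  rnorm (down u) ^+ 2 + rnorm (adjoint 'down_1 (adjoint 'down_0 (down u))) ^+ 2
    <= 2 * rnorm (adjoint 'down_0 (down u)) ^+ 2.

(** With v = D_1 z + u and A x close to v, expanding |v - A x|^2 bounds |v|^2 by 2<A x, v> - |A x|^2
    up to a small error. Moving adjoints splits <A x, v> into pairings with z and with D_0 u, and
    (1) absorbs the terms in x. *)
Lemma down_ineq0 (z : level 2) (u : level 1) :
  rnorm (down z + u) ^+ 2 <= 2 * (rnorm z ^+ 2 + rnorm (down u) ^+ 2).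
Proof.
have b0 : bounded_operator 'down_0 := down_bounded ten S_cb 0.
have b1 : bounded_operator 'down_1 := down_bounded ten S_cb 1.
pose a (x : level 1) := adjoint 'down_0 (down x).
have la : linear a.
  by move=> c x y; rewrite /a b0.1 (adjoint_bounded b0).1.
(* A vector h orthogonal to the range of T~^* T~ has |T~ h|^2 = 0, so injectivity makes the range
   dense. *)
have a_total : closed_span (a @` setT) = setT.
  apply: closed_subspace_full => [|h hS]; first exact: closed_span_closed.
  apply: down0_inj; apply: hdot_eq0; rewrite (adjointP b0); apply: hS.
  by apply: sub_closed_span; exists h.
set v := down z + u; apply/ler_addgt0Pr => e e0.
have se0 : 0 < Num.sqrt e by rewrite sqrtr_gt0.
have vS : closed_span (a @` setT) v by rewrite a_total.
have cT : closed_subspace [set: level 1] by split=> //; exact: closedT.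
have [x _ vx] := closed_span_image_approx la cT vS se0.
have dot_av : rdot (a x) v = rdot (adjoint 'down_1 (a x)) z + rdot (down x) (down u).
  rewrite /v rdotDr [rdot (a x) (down z)]rdotC (adjoint_rdot b1) rdotC; congr (_ + _).
  by rewrite /a rdotC -(adjoint_rdot b0) rdotC.
have := down0_ineq x; rewrite -/(a x).
have : rnorm (v - a x) ^+ 2 <= e.
  rewrite -[leRHS](sqr_sqrtr (ltW e0)).
  by rewrite ler_sqr ?nnegrE ?rnorm_ge0 ?(ltW se0) // ltW.
rewrite rnorm_sqrB rdotC dot_av.
(* Doubled, these weights give half the left side of (1) plus exactly the right side of the
   claim. *)
have amgm (V : hilbertType R) (p q : V) : rdot p q <= rnorm p ^+ 2 / 4 + rnorm q ^+ 2.
  have := rdot_CauchySchwarz p q; have := sqr_ge0 (rnorm p / 2 - rnorm q).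
  nra.
have := amgm _ (adjoint 'down_1 (a x)) z; have := amgm _ (down x) (down u).
lra.
Qed.

(** The inequality is positivity of an operator on pairs; [tensor_ge0] lifts it to finite sums one
    level up, and density to all vectors. *)
Lemma down_ineqS n :
  (forall (z : level n.+2) (u : level n.+1),
    rnorm (down z + u) ^+ 2 <= 2 * (rnorm z ^+ 2 + rnorm (down u) ^+ 2)) ->
  forall (z : level n.+3) (u : level n.+2),
    rnorm (down z + u) ^+ 2 <= 2 * (rnorm z ^+ 2 + rnorm (down u) ^+ 2).
Proof.
move=> IH.
have bd k : bounded_operator 'down_k := down_bounded ten S_cb k.
have ld k : linear 'down_k := (bd k).1.
have lS k x : linear (shift x : level k -> level k.+1) :=
  (@shift_bounded _ _ _ _ _ ten tenH k x).1.
pose q (p p' : (level n.+3 * level n.+2)%type) :=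
  2 * (rdot p.1 p'.1 + rdot (down p.2) (down p'.2))
    - rdot (down p.1 + p.2) (down p'.1 + p'.2).
(* The operator of the quadratic form 2(|z|^2 + |D_n u|^2) - |D_(n+1) z + u|^2. *)
pose B (p : (level n.+2 * level n.+1)%type) : (level n.+2 * level n.+1)%type :=
  ((2 : R)%:C%C *: p.1 - adjoint 'down_n.+1 (down p.1 + p.2),
   (2 : R)%:C%C *: adjoint 'down_n (down p.2) - (down p.1 + p.2)).
pose b := prod_form (hform (level n.+2)) (hform (level n.+1)).
have bB (p p' : (level n.+2 * level n.+1)%type) :
    b (B p) p' = 2 * (rdot p.1 p'.1 + rdot (down p.2) (down p'.2))
    - rdot (down p.1 + p.2) (down p'.1 + p'.2).
  rewrite /b /B /= !rdotBl !rdotZl !rdotDl !rdotDr.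
  have adjr k (x : level k.+1) y : rdot (adjoint 'down_k y) x = rdot y (down x).
    by rewrite rdotC -(adjoint_rdot (bd k)) rdotC.
  by rewrite (adjr n.+1) (adjr n) !rdotDl; ring.
have [_ [M M0 dM]] := iffLR (bounded_rnorm _) (bd n).
have sums (s : seq (E * (level n.+2 * level n.+1))) :
    0 <= q (\sum_(p <- s) (shift p.1 p.2.1, shift p.1 p.2.2))
           (\sum_(p <- s) (shift p.1 p.2.1, shift p.1 p.2.2)).
  apply: (@tensor_ge0 _ _ _ b (prod_form (hform (level n.+3)) (hform (level n.+2))) E
    (fun x p => (shift x p.1, shift x p.2)) _ _ _
    (fun x p => (shift x p.1, shift x p.2)) q B (2 + 2 * M ^+ 2) s).
  - by move=> x c p p' /=; rewrite !lS.
  - move=> x; have [C1 C10 C1P] := @shift_norm_le _ _ _ _ S ten tenH n.+2 x.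
    have [C2 C20 C2P] := @shift_norm_le _ _ _ _ S ten tenH n.+1 x.
    exists (C1 + C2) => [|p]; first exact: addr_ge0.
    have := C1P p.1; have := C2P p.2; have := rdot_ge0 p.1; have := rdot_ge0 p.2.
    rewrite /b /=; nra.
  - move=> p p' p''; rewrite /q /=.
    by rewrite (linearD_of (ld n.+2)) (linearD_of (ld n.+1)) !rdotDl; ring.
  - by move=> p p'; rewrite /q; congr (2 * (_ + _) - _); exact: rdotC.
  - by have := sqr_ge0 M; lra.
  - move=> c p p'; rewrite /B /=.
    have -> : down (c *: p.1 + p'.1) + (c *: p.2 + p'.2)
        = c *: (down p.1 + p.2) + (down p'.1 + p'.2).
      by rewrite ld scalerDr addrACA.
    have twoB (V : lmodType R[i]) (x x' y y' : V) :
        (2 : R)%:C%C *: (c *: x + x') - (c *: y + y')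
        = c *: ((2 : R)%:C%C *: x - y) + ((2 : R)%:C%C *: x' - y').
      by rewrite scalerDr scalerBr !scalerA mulrC opprD addrACA.
    by rewrite (adjoint_bounded (bd n.+1)).1 ld (adjoint_bounded (bd n)).1 !twoB.
  - move=> p p'; rewrite bB [RHS]ipC bB.
    by congr (2 * (_ + _) - _); exact: rdotC.
  (* The lower bound is [IH]; the upper one drops the negative square, leaving at most 2|z|^2 + 2M^2
     |u|^2. *)
  - move=> p; rewrite bB -[b p p]/(rdot p.1 p.1 + rdot p.2 p.2) !rdot_rnorm.
    have := IH p.1 p.2; have := sqr_ge0 (rnorm (down p.1 + p.2)).
    have : rnorm (down p.2) ^+ 2 <= (M * rnorm p.2) ^+ 2.
      by rewrite ler_sqr ?nnegrE ?rnorm_ge0 ?mulr_ge0 ?rnorm_ge0 ?(ltW M0).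
    have := sqr_ge0 (rnorm p.2).
    have : 0 <= (M * rnorm p.1) ^+ 2 by exact: sqr_ge0.
    rewrite !exprMn => h1 h2 h3 h4 h5; apply/andP; split; nra.
  - move=> x y p p'.
    rewrite -[LHS]/(rdot (shift x (B p).1) (shift y p'.1)
                    + rdot (shift x (B p).2) (shift y p'.2)) /q /B /=.
    rewrite !(linearB_of (lS _ x)) !(linearZ_of (lS _ x)) !rdotBl !rdotZl.
    have sad k v u : rdot (shift x (adjoint 'down_k.+1 v)) (shift y u)
        = rdot (shift x v) (shift y (down u)).
      by rewrite /rdot shift_adjoint_dot //; exact: down_act.
    have sad0 v u : rdot (shift x (adjoint 'down_n v)) (shift y u)
        = rdot (shift x v) (shift y (down u)).
      by rewrite /rdot shift_adjoint_dot //; exact: down_act.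
    rewrite sad sad0 !(down_shift S_cb) (linearD_of (lS n.+1 x)) !rdotDl !rdotDr.
    by ring.
have [_ [N1 N10 N1P]] := iffLR (bounded_rnorm _) (bd n.+2).
have [_ [N2 N20 N2P]] := iffLR (bounded_rnorm _) (bd n.+1).
move=> z u; apply: sqr_le_limit; rewrite ?rnorm_ge0 // => t t0 t1.
(* The three approximation errors are at most (N1 + 1)e, e and N2 e. *)
pose e := t / (N1 + N2 + 1).
have e0 : 0 < e by rewrite divr_gt0 //; lra.
have eE : e * (N1 + N2 + 1) = t by rewrite divfK //; lra.
have approx k (v : level k.+1) : exists s : seq (E * level k),
    rnorm (v - \sum_(p <- s) shift p.1 p.2) < e.
  have vS : closed_span [set w | exists x (u : level k), w = shift x u] v.
    by rewrite shift_total.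
  have [s] := closed_span_approx (@shift_sub_range _ _ _ _ _ ten tenH k) vS e0.
  by rewrite lincomb_shift => ?; exists [seq (p.2.1, p.1 *: p.2.2) | p <- s].
have [s1 zs] := approx _ z; have [s2 us] := approx _ u.
set z' := \sum_(p <- s1) _ in zs; set u' := \sum_(p <- s2) _ in us.
exists (rnorm (down z' + u')), (rnorm z'), (rnorm (down u')).
rewrite !rnorm_ge0; split; split=> //.
- have -> : down z + u = (down z' + u') + (down (z - z') + (u - u')).
    by rewrite (linearB_of (ld n.+2)) addrACA !subrKC.
  apply: le_trans (rnormD _ _) _; rewrite lerD2l.
  apply: le_trans (rnormD _ _) _; have := N1P (z - z'); nra.
- by have := rnormB z (z - z'); rewrite subKr; nra.
- have -> : down u' = down u - down (u - u') by rewrite -(linearB_of (ld n.+1)) subKr.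
  by apply: le_trans (rnormB _ _) _; have := N2P (u - u'); nra.
(* The approximants of z and u come from different lists; padding with zeros merges them into one
   list of pairs. *)
pose s := [seq (p.1, (p.2, 0 : level n.+1)) | p <- s1]
  ++ [seq (p.1, (0 : level n.+2, p.2)) | p <- s2].
have := sums s; rewrite big_cat !big_map /=.
have -> : \sum_(p <- s1) (shift p.1 p.2, shift p.1 (0 : level n.+1)) = (z', 0).
  rewrite /z'; elim: (s1) => [|p r IHr]; first by rewrite !big_nil.
  by rewrite !big_cons IHr (linear0_of (lS _ _)) -[LHS]/(_, 0 + 0) addr0.
have -> : \sum_(p <- s2) (shift p.1 (0 : level n.+2), shift p.1 p.2) = (0, u').
  rewrite /u'; elim: (s2) => [|p r IHr]; first by rewrite !big_nil.
  by rewrite !big_cons IHr (linear0_of (lS _ _)) -[LHS]/(0 + 0, _) addr0.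
rewrite -[(z', 0) + (0, u')]/(z' + 0, 0 + u') addr0 add0r /q /= !rdot_rnorm.
by rewrite subr_ge0.
Qed.

End Shimorin.

(** * Wandering subspaces *)

(** By concavity a strict drop recurs at every later step, which would make the sequence negative.
    Hence it is nondecreasing, and tending to 0 forces a_0 <= 0. *)
Lemma concave_to0 {R : realType} (a : nat -> R) :
  (forall n, a n + a n.+2 <= 2 * a n.+1) -> (forall n, 0 <= a n) ->
  (forall e, 0 < e -> exists N, forall n, (N <= n)%N -> a n < e) -> a 0%N = 0.
Proof.
move=> a_concave a_ge0 a_to0.
have a_incr n : a n <= a n.+1.
  rewrite leNgt; apply/negP => a_lt; pose d := a n - a n.+1.
  have d0 : 0 < d by rewrite subr_gt0.
  have a_le k : a (n + k)%N <= a n - k%:R * d /\ d <= a (n + k)%N - a (n + k).+1.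
    elim: k => [|k [IH1 IH2]]; first by rewrite addn0 mul0r subr0 lexx.
    rewrite addnS -natr1; have := a_concave (n + k)%N.
    by split; rewrite /= ?mulrDl ?mul1r; lra.
  have [] := a_le (Num.truncn (a n / d)).+1.
  have := truncnS_gt (a n / d); rewrite ltr_pdivrMr //.
  have := a_ge0 (n + (Num.truncn (a n / d)).+1)%N.
  by move=> h1 h2 h3; lra.
have a_mono n : a 0%N <= a n.
  by elim: n => // n IH; apply: le_trans IH _.
apply/eqP; rewrite eq_le a_ge0 andbT; apply/ler_addgt0Pr => e e0.
by have [N /(_ N (leqnn N))] := a_to0 e e0; rewrite add0r => /ltW; apply: le_trans.
Qed.

Lemma closed_span_orth {R : realType} {H : hilbertType R} (S T : set H) u v :
  (forall s t, S s -> T t -> hdot s t = 0) ->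
  closed_span S u -> closed_span T v -> hdot u v = 0.
Proof.
move=> ST uS vT.
have uT t : T t -> hdot u t = 0.
  suff : closed_span S `<=` [set h | forall s, T s -> hdot h s = 0].
    by move=> /(_ u uS); apply.
  by apply: closed_span_min => [|s Ss t' Tt]; [exact: closed_subspace_orth|exact: ST].
rewrite hdotC; suff : closed_span T `<=` [set h | forall s, [set u] s -> hdot h s = 0].
  by move=> /(_ v vT) /= -> //; rewrite rmorph0.
apply: closed_span_min; first exact: closed_subspace_orth.
by move=> t /uT tu _ ->; rewrite hdotC tu rmorph0.
Qed.

Section wandering.
Context {R : realType} {A : cstarAlgType R} {E : cstarCorrType A}.
Context {H : hilbertType R} (S : covariant_rep E H).
Context (ten : forall F : cstarCorrType A, interior_tensor E F).
Context (tenH : forall F : hilbertModType A, hilbert_tensor F (sigma S)).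
Hypothesis S_cb : completely_bounded tenH.

Local Notation level := (level ten tenH).
Local Notation shift := (shift (ten := ten) (tenH := tenH)).
Local Notation span K n := (@level_span _ _ _ _ _ ten tenH K n).
Local Notation "'down_ n" := (@down R A E H S ten tenH n)
  (at level 0, n at level 2).
Local Notation "'collapse_ n" := (@collapse R A E H S ten tenH n)
  (at level 0, n at level 2).

Let bd n : bounded_operator 'down_n := down_bounded ten S_cb n.
Let bc n : bounded_operator 'collapse_n := collapse_bounded ten S_cb n.
Let bs n x : bounded_operator (shift x : level n -> level n.+1).
Proof. exact: shift_bounded. Qed.

Context (K : set H).
Hypothesis K_inv : invariant_subspace S K.
Let W := wandering_subspace tenH K.

Let cK : closed_subspace K. Proof. by have [] := K_inv. Qed.

Lemma down_span n u : span K n.+1 u -> span K n (down u).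
Proof.
have cP m := closed_subspace_preimage (bd m) (level_span_closed ten tenH m cK).
elim: n u => [|n IH] u; rewrite -level_spanS => Ku; apply: (closed_span_min (cP _)) Ku.
  move=> _ [x [k [Kk ->]]] /=; rewrite down0_shift //.
  by have [_ _ KT] := K_inv; exact: KT.
move=> _ [x [v [Kv ->]]] /=; rewrite down_shift //.
by apply: level_span_shift; exact: IH.
Qed.

(** For n = 0 this is the definition of [W]. Further up, <x ⊗ w, y ⊗ Dv> = <w, D(<x, y> v)>, and the
    left action preserves E^(n+1) ⊗ K because [K] is invariant under [sigma]. *)
Lemma wandering_orth n w u : span W n w -> span K n.+1 u -> hdot w (down u) = 0.
Proof.
elim: n w u => [|n IH] w u; first by move=> [_ wK] Ku; apply: wK; exists u.
rewrite -(level_spanS ten tenH W n) -(level_spanS ten tenH K n.+1) => Ww Ku.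
pose T := [set z : level n.+1 |
  exists y (v : level n.+1), span K n.+1 v /\ z = shift y (down v)].
apply: (@closed_span_orth _ _ _ T) Ww _ => [_ _ [x [w' [Ww ->]]] [y [v [Kv ->]]]|].
  rewrite shift_dot -(down_act S_cb); apply: IH => //.
  by have [_ Ka _] := K_inv; exact: level_span_act (Ka _) Kv.
apply: (closed_span_image (bd n.+1)) Ku => _ [y [v [Kv ->]]].
by apply: sub_closed_span; exists y, v; rewrite down_shift.
Qed.

(** For n = 0, subtracting the projection onto the closed span of the image of D_0 leaves a vector
    of [W]; tensoring with E preserves the decomposition. *)
Lemma wandering_span n u : span K n u ->
  closed_span (span W n `|` 'down_n @` span K n.+1) u.
Proof.
elim: n u => [|n IH] u Ku.
  have [p Np up] := projection u (closed_span_closed ('down_0 @` span K 1)).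
  have [_ SD _ _] := closed_subspaceP
    (closed_span_closed (span W 0 `|` 'down_0 @` span K 1)).
  rewrite -(subrK p u); apply: SD; last first.
    apply: closed_spanS Np => _ [v Kv <-]; apply: sub_closed_span.
    by right; exists v.
  apply: sub_closed_span; left; split.
    have [_ _ _ KB] := closed_subspaceP cK; apply: KB => //.
    apply: (closed_span_min cK) Np => _ [v Kv <-]; exact: (@down_span 0).
  by move=> l [v Kv <-]; apply: up; apply: sub_closed_span; exists v.
rewrite -(level_spanS ten tenH K n) in Ku.
apply: closed_spanS Ku => _ [x [v [Kv ->]]].
apply: (closed_span_image (bs n x)) (IH v Kv) => w [Ww|[y Ky <-]]; apply: sub_closed_span.
  by left; exact: level_span_shift.
by right; exists (shift x y); [exact: level_span_shift|rewrite down_shift].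
Qed.

Lemma collapse_span L n u : (forall m v, span L m.+1 v -> span L m (down v)) ->
  span L n u -> L (collapse u).
Proof. by move=> dL; elim: n u => [//|n IH] u Lu; apply/IH/dL. Qed.

Lemma Tn_image_collapse n : Tn_image ten tenH n W = 'collapse_n @` span W n.
Proof.
case: n => [|n]; first by rewrite /= image_id.
by rewrite /= (TtildeS_collapse ten S_cb).
Qed.

Hypothesis down_ineq : forall n (z : level n.+2) (u : level n.+1),
  rnorm (down z + u) ^+ 2 <= 2 * (rnorm z ^+ 2 + rnorm (down u) ^+ 2).
Hypothesis pure : forall h e, 0 < e -> exists N, forall n, (N <= n)%N ->
  rnorm (adjoint 'collapse_n.+1 h) < e.

Let cspan n : closed_subspace (span K n).
Proof. exact: level_span_closed. Qed.

Lemma level_span_sub (L L' : set H) n : L `<=` L' -> span L n `<=` span L' n.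
Proof.
case: n => [//|n] LL'; apply: closed_spanS => _ [x [k [Lk ->]]].
by apply: sub_closed_span; exists x, k; split=> //; exact: LL'.
Qed.

Lemma wandering_sub : W `<=` K. Proof. by move=> k []. Qed.

Lemma wandering_complement h : K h ->
  (forall n w, span W n w -> hdot h (collapse w) = 0) -> h = 0.
Proof.
move=> Kh hW.
(* The projection of T~_n^* h onto E^n ⊗ K, described by its pairings. *)
have gP n : exists g, span K n g /\
    forall u, span K n u -> hdot g u = hdot h (collapse u).
  have [g Kg gP] := projection (adjoint 'collapse_n h) (cspan n).
  exists g; split=> // u /gP; rewrite hdotBl adjointPr // => /eqP.
  by rewrite subr_eq0 => /eqP.
pose g n := sval (cid (gP n)).
have Kg n : span K n (g n) by rewrite /g; case: cid => g0 /= [Kg0 _].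
have gh n u : span K n u -> hdot (g n) u = hdot h (collapse u).
  by rewrite /g; case: cid => g0 /= [Kg0 g0P] Ku; exact: g0P.
have g_down n u : span K n.+1 u -> hdot (g n.+1) u = hdot (g n) (down u).
  by move=> Ku; rewrite !gh //; exact: down_span.
have g0 : g 0%N = h.
  apply/eqP; rewrite -subr_eq0; apply/eqP/hdot_eq0.
  have [_ _ _ KB] := closed_subspaceP cK.
  by rewrite [LHS]hdotBl gh ?subrr //; apply: KB => //; exact: (Kg 0%N).
have g_range n : closed_span ('down_n @` span K n.+1) (g n).
  have [p Np gp] := projection (g n) (closed_span_closed ('down_n @` span K n.+1)).
  have Kp : span K n p.
    by apply: (closed_span_min (cspan n)) Np => _ [v Kv <-]; exact: down_span.
  have [_ _ _ KB] := closed_subspaceP (cspan n).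
  suff /eqP : g n - p = 0 by rewrite subr_eq0 => /eqP ->.
  (* The remainder is orthogonal to both spanning pieces: to E^n ⊗ W by [hW] and [wandering_orth],
     to the image of D_n by the choice of p. *)
  have gpS := wandering_span (KB _ _ (Kg n) Kp).
  apply: hdot_eq0; apply: (@closed_span_orth _ _ [set g n - p] _) gpS;
    last exact: sub_closed_span.
  move=> _ w -> [Ww|[v Kv <-]]; last by apply: gp; apply: sub_closed_span; exists v.
  have Kw : span K n w by exact: (level_span_sub wandering_sub Ww).
  rewrite hdotBl gh // hW // sub0r; apply/eqP; rewrite oppr_eq0; apply/eqP.
  rewrite hdotC; apply/eqP; rewrite conjC_eq0; apply/eqP.
  apply: (@closed_span_orth _ _ [set w] _) Np; last exact: sub_closed_span.
  by move=> _ _ -> [v Kv <-]; exact: wandering_orth.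
pose a n := rnorm (g n) ^+ 2.
have a0 : a 0%N = 0.
  apply: (@concave_to0 _ a) => [n|n|e e0].
  - apply/ler_addgt0Pr => e e0; rewrite /a.
    have se0 : 0 < Num.sqrt e by rewrite sqrtr_gt0.
    have [u Ku gu] := closed_span_image_approx (bd n).1 (cspan n.+1) (g_range n) se0.
    have := down_ineq (g n.+2) u.
    set y := down (g n.+2) + u; set d := g n - down u in gu.
    have -> : down u = g n - d by rewrite subKr.
    have d2 : rnorm d ^+ 2 <= e.
      rewrite -[leRHS](sqr_sqrtr (ltW e0)).
      by rewrite ler_sqr ?nnegrE ?rnorm_ge0 ?(ltW se0) // ltW.
    have -> : rnorm (g n - d) ^+ 2 = rnorm (g n) ^+ 2 + rnorm d ^+ 2 - 2 * rdot (g n) d.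
      exact: rnorm_sqrB.
    have : rdot (g n.+1) y = rnorm (g n.+2) ^+ 2 + (rnorm (g n) ^+ 2 - rdot (g n) d).
      rewrite /y rdotDr {1}/rdot -g_down // -/(rdot _ _) rdot_rnorm; congr (_ + _).
      by rewrite {1}/rdot g_down // -/(rdot _ _) -rdot_rnorm -rdotBr subKr.
    have := rdot_CauchySchwarz (g n.+1) y.
    (* With s = |g_n|^2 + |g_(n+2)|^2 this gives s - <g_n, d> <= |g_(n+1)|^2 + |y|^2/4, and the dual
       inequality bounds |y|^2/4 by (s + |d|^2)/2 - <g_n, d>. The pairings with d cancel; only |d|^2
       <= e remains. *)
    have := sqr_ge0 (rnorm (g n.+1) - rnorm y / 2).
    nra.
  - exact: sqr_ge0.
  (* The minimum with 1 lets the bound on the norm pass to its square. [pure] speaks of T~_(n+1),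
     hence [N.+1]. *)
  - have d0 : 0 < Num.min 1 e by rewrite lt_min ltr01.
    have [N NP] := pure h d0; exists N.+1 => -[|n] // Nn; have := NP n Nn.
    set d := Num.min 1 e in d0 *; have : d <= e by rewrite ge_min lexx orbT.
    have : d <= 1 by rewrite ge_min lexx.
    have : rnorm (g n.+1) <= rnorm (adjoint 'collapse_n.+1 h).
      have [->|gN0] := eqVneq (rnorm (g n.+1)) 0; first exact: rnorm_ge0.
      have g_gt0 : 0 < rnorm (g n.+1) by rewrite lt_def gN0 rnorm_ge0.
      rewrite -(ler_pM2r g_gt0) -expr2 -rdot_rnorm {1}/rdot gh //.
      by rewrite -adjointPr //; exact: rdot_CauchySchwarz.
    rewrite /a; have := rnorm_ge0 (g n.+1); nra.
by rewrite -g0; apply: rnorm_eq0; apply/eqP; rewrite -sqrf_eq0 -/(a 0%N) a0.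
Qed.

(** The part of [h] orthogonal to the right side still lies in [K], so [wandering_complement]
    annihilates it. *)
Lemma wandering_generates :
  K = closed_span (\bigcup_n Tn_image ten tenH n W).
Proof.
set T := \bigcup_n _; have TK : closed_span T `<=` K.
  apply: closed_span_min => // k [n _]; rewrite Tn_image_collapse => -[u Wu <-].
  exact: (collapse_span down_span) (level_span_sub wandering_sub Wu).
apply/seteqP; split=> // h Kh.
have [p Tp hp] := projection h (closed_span_closed T).
have [_ _ _ KB] := closed_subspaceP cK.
suff /eqP : h - p = 0 by rewrite subr_eq0 => /eqP ->.
apply: wandering_complement => [|n w Ww]; first by apply: KB => //; exact: TK.
apply: hp; apply: sub_closed_span; exists n => //.
by rewrite Tn_image_collapse; exists w.
Qed.

End wandering.

Theorem theorem3p9 (R : realType) (A : cstarAlgType R) (E : cstarCorrType A)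
    (H : hilbertType R) (S : covariant_rep E H)
    (ten : forall F : cstarCorrType A, interior_tensor E F)
    (tenH : forall F : hilbertModType A, hilbert_tensor F (sigma S))
    (S_cb : completely_bounded tenH)
    (S_ineq : forall eta : tenH E,
      `|Ttilde tenH eta| ^+ 2
        + `|adjoint (TtildeS ten tenH 1) (Ttilde tenH eta)| ^+ 2
      <= 2%:R * `|adjoint (Ttilde tenH) (Ttilde tenH eta)| ^+ 2)
    (S_bounded_below : bounded_below tenH)
    (S_pure : forall h : H,
      `|adjoint (TtildeS ten tenH n) h| @[n --> \oo] --> (0 : R[i]^o)) :
  Beurling_type ten tenH.
Proof.
have bd n : bounded_operator (@down _ _ _ _ _ ten tenH n) := down_bounded ten S_cb n.
move=> K K_inv; apply: (wandering_generates S_cb K_inv) => [|h e e0]; last first.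
  have /cvgrPdist_lt/(_ e%:C%C) := S_pure h; rewrite ltcR => /(_ e0)[N _ NP].
  exists N => n Nn; have := NP n Nn.
  by rewrite sub0r normrN normr_id rnormE ltcR (TtildeS_collapse ten S_cb).
elim=> [|n IH]; last exact: down_ineqS IH.
apply: down_ineq0 => // u.
  (* Boundedness below enters as injectivity of T~. *)
  move=> u0; have [c c0 cu] := S_bounded_below; apply/eqP.
  rewrite -normr_le0 -(pmulr_rle0 _ c0); apply: le_trans (cu u) _.
  by rewrite [Ttilde _ _]u0 normr0.
have := S_ineq u; rewrite (TtildeS_collapse ten S_cb).
(* T~_2 = T~ (I ⊗ T~) holds by conversion, so T~_2^* factors as D_1^* D_0^*, the form used by
   [down_ineq0]. *)
have -> : @collapse _ _ _ _ _ ten tenH 2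
    = Ttilde tenH \o @down _ _ _ _ _ ten tenH 1 by [].
rewrite (adjoint_comp (bd 1%N) (bd 0%N)).
rewrite !rnormE -!(rmorphXn (real_complex R)) -(rmorphD (real_complex R)).
rewrite -(rmorph_nat (real_complex R)) -(rmorphM (real_complex R)) lecR.
exact.
Qed.
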